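(* Let $\nu>-1$. Then the radius of uniform convexity $r^{uc}(h_\nu)$ of the function $z\mapsto h_\nu(z)=2^\nu\Gamma(\nu+1)z^{1-\frac{\nu}{2}}J_\nu(\sqrt z)$ is the smallest positive root of the equation $$h_\nu'(z)+2zh_\nu''(z)=0$$ and satisfies, for every positive integer $k$, $$\sigma_k^{-\frac1k}<r^{uc}(h_\nu)<\frac{\sigma_k}{\sigma_{k+1}},$$ where $\sigma_1,\sigma_2,\ldots$ are given by $$-\sigma_{n+1}=\sum_{m=0}^{n}\pi_m\,\lambda_{n-m},\qquad n\ge0,$$ with $$\lambda_n=\frac{(-1)^{n+1}(n+1)(n+2)(2n+3)}{2^{2n+2}\,(n+1)!\,(\nu+1)_{n+1}},\qquad \mu_n=\frac{(-1)^n(n+1)(2n+1)}{2^{2n}\,n!\,(\nu+1)_n},\qquad f_n=\frac{\mu_{n+1}}{\mu_1},$$ $$\pi_0=1,\qquad \pi_m=\sum_{p=1}^{m}(-1)^p\mu_1^p\,A_{p,m-p}(f_1,\ldots,f_{m-p})\quad(m\ge1).$$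
   Context: $J_\nu$ is the Bessel function of the first kind of real order $\nu$; $h_\nu(z)=\sum_{n\ge0}\frac{(-1)^n z^{n+1}}{4^n n!\,(\nu+1)_n}$ is entire, with $(a)_n=a(a+1)\cdots(a+n-1)$, $(a)_0=1$. For a function $f(z)=z+a_2z^2+\cdots$, the radius of convexity is $$r^c(f)=\sup\left\{r\in(0,\infty):\ \operatorname{Re}\left(1+\frac{zf''(z)}{f'(z)}\right)>0\ \text{for all } |z|<r\right\}$$ and the radius of uniform convexity is $$r^{uc}(f)=\sup\left\{r\in(0,r^c(f)):\ \operatorname{Re}\left(1+\frac{zf''(z)}{f'(z)}\right)>\left|\frac{zf''(z)}{f'(z)}\right|\ \text{for all } |z|<r\right\}.$$ The ordinary potential polynomials $A_{m,n}(f_1,\ldots,f_n)$ are defined by $\left(1+\sum_{n\ge1}f_nx^n\right)^m=\sum_{n\ge0}A_{m,n}(f_1,\ldots,f_n)x^n$; explicitly $$A_{m,n}(f_1,\ldots,f_n)=\sum\binom{m}{p}\frac{p!}{p_1!\cdots p_n!}f_1^{p_1}\cdots f_n^{p_n},$$ the sum being over all nonnegative integers $p_1,\ldots,p_n$ with $p_1+2p_2+\cdots+np_n=n$, where $p=p_1+\cdots+p_n$; $A_{m,0}=1$. *)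

(* Defs.v *)
From HB Require Import structures.
From mathcomp Require Import all_boot all_order all_algebra.
From mathcomp Require Export complex.
From mathcomp Require Import all_classical all_reals all_analysis.

Set Implicit Arguments.
Unset Strict Implicit.
Unset Printing Implicit Defensive.

Import Order.TTheory GRing.Theory Num.Theory.
Import numFieldNormedType.Exports.

Local Open Scope classical_set_scope.
Local Open Scope ring_scope.
Local Open Scope complex_scope.

Section ComplexAnalysis.
Variable R : realType.
Implicit Types (f : R[i] -> R[i]) (z w : R[i]) (x a nu : R).

(* R[i] only gets its normed topology through the alias R[i]^o. *)
Definition csum (u : nat -> R[i]) : R[i] :=
  limn (series (u : nat -> R[i]^o)).

Definition cderiv f : R[i] -> R[i] :=
  @derive1 (R[i] : numFieldType) (R[i]^o : normedModType R[i]) f.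

(* The principal argument, in ]-pi, pi] for z != 0. *)
Definition carg z : R :=
  let t := acos (complex.Re z / complex.Re `|z|) in
  if 0 <= complex.Im z then t else - t.

(* The principal branch of z^a, for a real exponent. *)
Definition cpowR z a : R[i] :=
  (complex.Re `|z| `^ a)%:C * (cos (a * carg z) +i* sin (a * carg z)).

Definition pochhammer a (n : nat) : R := \prod_(i < n) (a + i%:R).

(* Gauss's limit n! n^x / (x (x+1) ... (x+n)), which makes sense for every real
   x except 0, -1, -2, ... At these poles the convention y / 0 = 0 gives the
   value 0, whose inverse 0 is the value of the entire function 1 / Gamma. *)
Definition Gamma x : R :=
  limn (fun n : nat => n`!%:R * n%:R `^ x / pochhammer x n.+1).

(* Bessel function of the first kind, principal branch. *)
Definition besselJ nu w : R[i] :=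
  cpowR (w / 2) nu *
  csum (fun n => ((-1) ^+ n / (n`!%:R * Gamma (nu + n%:R + 1)))%:C
                 * (w / 2) ^+ (2 * n)).

Definition bessel_h nu z : R[i] :=
  csum (fun n => ((-1) ^+ n / (4 ^+ n * n`!%:R * pochhammer (nu + 1) n))%:C
                 * z ^+ n.+1).

(* z f''(z) / f'(z) *)
Definition convexity_quotient f z : R[i] :=
  z * cderiv (cderiv f) z / cderiv f z.

(* 'Re, `|.| and < are those of the numClosedField R[i]: 'Re w and `|w| are
   complex numbers with zero imaginary part, on which < is the order of R.
   The condition f'(z) != 0 only says that the quotient is defined. The radii
   are extended reals: +oo is a possible value. *)
Definition radius_convexity f : \bar R :=
  ereal_sup [set r%:E | r in [set r : R | 0 < r /\
    forall z, `|z| < r%:C ->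
      cderiv f z != 0 /\ 0 < 'Re (1 + convexity_quotient f z)]].

Definition radius_uniform_convexity f : \bar R :=
  ereal_sup [set r%:E | r in
    [set r : R | [/\ 0 < r, (r%:E < radius_convexity f)%E &
      forall z, `|z| < r%:C ->
        cderiv f z != 0 /\
        `|convexity_quotient f z| < 'Re (1 + convexity_quotient f z)]]].

Definition smallest_positive_root (F : R[i] -> R[i]) (r : R) : Prop :=
  [/\ 0 < r, F r%:C = 0 & forall s : R, 0 < s -> F s%:C = 0 -> r <= s].

End ComplexAnalysis.

Section PotentialPolynomials.
Variable R : realType.
Implicit Types (f : nat -> R) (nu : R).

(* A_{m,n}(f_1, ..., f_n): the coefficient of x^n in the m-th power of the
   formal power series 1 + sum_{k >= 1} f_k x^k. The terms with k > n do not
   contribute (see potential_polyE). The value f 0 is never used. *)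
Definition potential_poly (m n : nat) f : R :=
  ((1 + \sum_(1 <= k < n.+1) f k *: 'X^k) ^+ m)`_n.

Lemma potential_polyE (m n N : nat) f : (n <= N)%N ->
  ((1 + \sum_(1 <= k < N.+1) f k *: 'X^k) ^+ m)`_n = potential_poly m n f.
Proof.
rewrite /potential_poly => nN.
have E j : (j <= n)%N ->
    (1 + \sum_(1 <= k < N.+1) f k *: 'X^k)`_j =
    (1 + \sum_(1 <= k < n.+1) f k *: 'X^k)`_j.
  move=> jn; rewrite !coefD; congr (_ + _).
  rewrite (big_cat_nat (n := n.+1)) //= coefD [X in _ + X](_ : _ = 0) ?addr0//.
  rewrite coef_sum big_nat_cond big1 // => k /andP[/andP[nk _] _].
  by rewrite coefZ coefXn ltn_eqF ?mulr0 // (leq_ltn_trans jn).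
move: (leqnn n); move: {1 3 5}n.
elim: m => [|m IH] j jn; first by rewrite !expr0.
rewrite !exprS !coefM; apply: eq_bigr => i _.
by rewrite E ?IH // ?(leq_trans (leq_subr _ _)) // (leq_trans _ jn) // -ltnS.
Qed.

Definition lambda_coef nu (n : nat) : R :=
  ((-1) ^+ n.+1 * (n.+1 * n.+2 * (2 * n + 3))%:R) /
  (2 ^+ (2 * n + 2) * (n.+1)`!%:R * pochhammer (nu + 1) n.+1).

Definition mu_coef nu (n : nat) : R :=
  ((-1) ^+ n * (n.+1 * (2 * n + 1))%:R) /
  (2 ^+ (2 * n) * n`!%:R * pochhammer (nu + 1) n).

Definition f_coef nu (n : nat) : R := mu_coef nu n.+1 / mu_coef nu 1.

Definition pi_coef nu (m : nat) : R :=
  if m == 0%N then 1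
  else \sum_(1 <= p < m.+1)
         (-1) ^+ p * mu_coef nu 1 ^+ p * potential_poly p (m - p) (f_coef nu).

End PotentialPolynomials.

(* Main.v *)
Require Import Defs.
From mathcomp Require Import all_boot all_order all_algebra.
From mathcomp Require Import complex.
From mathcomp Require Import all_classical all_reals all_analysis.
From mathcomp Require Import ring lra zify.
Set Implicit Arguments.
Unset Strict Implicit.
Unset Printing Implicit Defensive.
Import Order.TTheory GRing.Theory Num.Theory.
Import numFieldNormedType.Exports.
Local Open Scope classical_set_scope.
Local Open Scope ring_scope.
Local Open Scope complex_scope.

(** Write Delta := h' + 2 z h''.  Its Taylor coefficients are the mu_n, and
everything about h' and Delta is read off from polynomial approximations.

Let a polynomial be called positive-rooted if it is a finite product of
factors 1 - aX with a > 0.  If p is positive-rooted, so is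
p (1 - be X) + al X p' for al > 0 and be >= 0, because the quotient of this
polynomial by p is 1 - be z - al sum_a a z / (1 - a z), where every term of the
sum has an imaginary part of the sign of Im z (posrooted_step).  This step
builds the Laguerre polynomials one after the other.  Rescaled by 1/(4N) and
subjected to the step with be = 0, al = 1 and then al = 2, they give
positive-rooted polynomials H_N and D_N = H_N + 2 X H_N', whose coefficients
are those of h' and Delta multiplied by N (N-1) ... (N-n+1) / N^n.  By dominated
convergence H_N, H_N' and D_N converge to h', h'' and Delta (tannery).

The recursion that defines sigma says that sum_n sigma_(n+1) z^n is
- Delta' / Delta (sigma_newton).  By Newton's identities (newton_rootprod) the
power sums of the reciprocal roots of D_N therefore converge to the sigma_k
(cvg_psum), and inequalities between power sums pass to the limit: sigma is
log-convex, so sigma_(k+1) / sigma_k increases to a finite limit A, and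
A^k <= sigma_k.  The largest reciprocal root of D_N tends to A (cvg_maxs), hence
r := 1/A is a zero of Delta (pser_root) and Delta > 0 on [0, r[ (pser_gt0).  The
two bounds on r are strict: if sigma_(k+1) = A sigma_k for one k, then the
monotonicity of the ratios carries this upwards, and log-convexity of the
second differences carries it downwards to all k >= 2.  Then (1 - A z) Delta' is
a polynomial of degree at most 1 times Delta, which the fast decay of the mu_n
forbids (mu_nondegenerate).

For |z| = x < r the roots of H_N leave the disc of radius x, and the bound
|z H_N'(z) / H_N(z)| <= - x H_N'(x) / H_N(x), valid for products
(cabs_logderiv_le), gives in the limit
|z h''(z) / h'(z)| <= (1 - Delta(x) / h'(x)) / 2 < 1/2 (quotient_lt_half).  A
complex number q with |q| < 1/2 satisfies |q| < Re (1 + q), while at z = r one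
has q = -1/2, where both sides are equal.  So r is the radius.

The relation with J_nu follows from the convergence of Gauss's product, from
Gamma (x + 1) = x Gamma x, and from the multiplicativity of principal powers
at z and at the square root of z (cpowR_half_pow). *)

(** * Products of factors 1 - aX with positive a *)

(** Products are parametrized by the reciprocals of their roots: these stay bounded
in the limits taken below, and the constant coefficient is normalized to 1. *)
Definition rootprod (F : comNzRingType) (s : seq F) : {poly F} :=
  \prod_(a <- s) (1 - a *: 'X).

Lemma rootprod_cons (F : comNzRingType) (a : F) s :
  rootprod (a :: s) = (1 - a *: 'X) * rootprod s.
Proof. by rewrite /rootprod big_cons. Qed.

Lemma horner_rootprod (F : comNzRingType) (s : seq F) x :
  (rootprod s).[x] = \prod_(a <- s) (1 - a * x).
Proof.
rewrite /rootprod horner_prod; apply: eq_bigr => a _.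
by rewrite !hornerE.
Qed.

Lemma map_rootprod (F G : comNzRingType) (f : {rmorphism F -> G}) s :
  map_poly f (rootprod s) = rootprod (map f s).
Proof.
rewrite /rootprod rmorph_prod big_map; apply: eq_bigr => a _.
by rewrite rmorphB rmorph1 /= map_polyZ map_polyX.
Qed.

Lemma deriv_rootprod_cons (F : comNzRingType) (a : F) s x :
  (rootprod (a :: s))^`().[x] =
  (1 - a * x) * (rootprod s)^`().[x] - a * (rootprod s).[x].
Proof.
rewrite rootprod_cons derivM derivB derivZ derivX -[1 : {poly F}]/(1%:P) derivC.
by rewrite sub0r !hornerE; ring.
Qed.

Lemma logderiv_rootprod (F : fieldType) (s : seq F) x :
    (rootprod s).[x] != 0 ->
  x * (rootprod s)^`().[x] =
  - (rootprod s).[x] * \sum_(a <- s) (a * x / (1 - a * x)).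
Proof.
elim: s => [|a s IH].
  by rewrite /rootprod big_nil -[1 : {poly F}]/(1%:P) derivC horner0 big_nil !mulr0.
rewrite deriv_rootprod_cons big_cons rootprod_cons hornerM.
have -> : (1 - a *: 'X).[x] = 1 - a * x by rewrite !hornerE.
rewrite mulf_eq0 negb_or => /andP[a0 /IH E].
by rewrite mulrBr mulrCA E; field.
Qed.

Definition posrooted (F : numDomainType) (p : {poly F}) : Prop :=
  exists2 s, {in s, forall a, 0 < a} & p = rootprod s.

Section PosRooted.
Variable R : rcfType.
Notation toC := (real_complex R).

Lemma sqr_modulus_1B_gt0 (a : R) (z : R[i]) : 1 - a%:C * z != 0 ->
  0 < (1 - a * complex.Re z) ^+ 2 + (a * complex.Im z) ^+ 2.
Proof.
move=> nz; rewrite lt0r addr_ge0 ?sqr_ge0 // andbT.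
apply: contra nz; case: (z) => x y /=.
rewrite paddr_eq0 ?sqr_ge0 // !sqrf_eq0 => /andP[/eqP e1 /eqP e2].
rewrite eq_complex /=; apply/andP; split; apply/eqP; move: e1 e2; lra.
Qed.

(** For a > 0 the imaginary part has the sign of Im z, and if z is real and z <= 0,
then the real part is not positive. *)
Lemma mobius_complexE (a : R) (z : R[i]) : 1 - a%:C * z != 0 ->
  a%:C * z / (1 - a%:C * z) =
  ((a * complex.Re z - a ^+ 2 * (complex.Re z ^+ 2 + complex.Im z ^+ 2))
     / ((1 - a * complex.Re z) ^+ 2 + (a * complex.Im z) ^+ 2))
  +i* (a * complex.Im z / ((1 - a * complex.Re z) ^+ 2 + (a * complex.Im z) ^+ 2)).
Proof.
move=> nz; have den0 := sqr_modulus_1B_gt0 nz; move: nz den0.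
case: z => x y /= nz /lt0r_neq0 nz2.
apply: (mulIf nz); rewrite divfK //; apply/eqP; rewrite eq_complex /=.
by apply/andP; split; apply/eqP; field.
Qed.

(** Where p does not vanish, the polynomial is p times
1 - be z - al sum_a a z / (1 - a z).  The imaginary part of the second factor is
- Im z times a positive number, unless be = 0 and p = 1, in which case there is
no root; for a real z <= 0 the factor is at least 1. *)
Lemma posrooted_root (p : {poly R}) (al be : R) (z : R[i]) :
    posrooted p -> 0 < al -> 0 <= be ->
    root (map_poly toC (p * (1 - be *: 'X) + al *: ('X * p^`()))) z ->
  exists2 x, 0 < x & z = x%:C.
Proof.
move=> [s s0 ->] al0 be0.
have [|pz0 ] := boolP (root (map_poly toC (rootprod s)) z).
  rewrite map_rootprod /root horner_rootprod prodf_seq_eq0 => /hasP[_ /mapP[a /s0 a0 ->]].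
  rewrite /= subr_eq0 => /eqP E _; exists a^-1; first by rewrite invr_gt0.
  have aC0 : a%:C != 0 by rewrite fmorph_eq0 gt_eqF.
  by rewrite fmorphV; apply: (mulfI aC0); rewrite -E divff.
rewrite /root rmorphD rmorphM /= map_polyZ rmorphM /= map_polyX rmorphB rmorph1 /=.
rewrite map_polyZ map_polyX -deriv_map map_rootprod !hornerE /=.
rewrite -[_ * z * _]mulrA logderiv_rootprod; last first.
  by rewrite -map_rootprod.
set P := (rootprod _).[z]; set S := \sum_(_ <- _) _.
have Pz : P != 0 by rewrite /P -map_rootprod.
rewrite [X in X == 0](_ : _ = P * (1 - be%:C * z - al%:C * S)); last by ring.
rewrite mulf_eq0 (negPf Pz) /= => /eqP E.
have nz a : a \in s -> 1 - a%:C * z != 0.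
  move=> sa; apply: contra Pz => a0; rewrite /P horner_rootprod prodf_seq_eq0.
  by apply/hasP; exists a%:C; rewrite ?map_f.
pose D a := (1 - a * complex.Re z) ^+ 2 + (a * complex.Im z) ^+ 2.
have den0 a : a \in s -> 0 < D a by move=> /nz; exact: sqr_modulus_1B_gt0.
have ES : S = (\sum_(a <- s) ((a * complex.Re z
     - a ^+ 2 * (complex.Re z ^+ 2 + complex.Im z ^+ 2)) / D a))
   +i* (complex.Im z * \sum_(a <- s) (a / D a)).
  rewrite /S big_map mulr_sumr.
  elim: (s) nz => [|a t IH] nz; first by rewrite !big_nil.
  rewrite !big_cons IH ?mobius_complexE ?nz ?mem_head //; last first.
    by move=> b tb; rewrite nz // in_cons tb orbT.
  apply/eqP; rewrite eq_complex /= -/(D a); apply/andP; split; apply/eqP => //.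
  by rewrite -mulrA mulrCA.
have T0 : 0 <= \sum_(a <- s) (a / D a).
  rewrite big_seq; apply: sumr_ge0 => a sa.
  by apply: divr_ge0; apply: ltW; [exact: s0|exact: den0].
move: E; rewrite ES; set U := \sum_(a <- s) (_ - _) / _; set T := \sum_(a <- s) _ in T0 *.
case Ez: z => [x y] /=; rewrite Ez /= in U T0 *.
move=> /eqP; rewrite eq_complex /= => /andP[/eqP E1 /eqP E2].
have EI : y * (be + al * T) = 0 by rewrite -[RHS]oppr0 -E2; ring.
have y0 : y = 0.
  move/eqP: EI; rewrite mulf_eq0 => /orP[/eqP //|].
  rewrite paddr_eq0 ?mulr_ge0 ?(ltW al0) // mulf_eq0 (gt_eqF al0) /= => /andP[/eqP be00 /eqP T00].
  move: E1; rewrite be00.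
  suff -> : U = 0 by move=> ?; lra.
  rewrite /U big_seq; apply: big1 => a sa.
  suff : a / D a = 0 by move/eqP; rewrite mulf_eq0 invr_eq0 (gt_eqF (s0 _ sa)) (gt_eqF (den0 _ sa)).
  move/eqP: T00; rewrite /T big_seq Num.Theory.psumr_eq0; last first.
    by move=> b sb; apply: divr_ge0; apply: ltW; [exact: s0|exact: den0].
  by move=> /allP /(_ _ sa) /implyP /(_ sa) /eqP.
clear E2; rewrite y0 /= in U E1 *.
exists x => //; rewrite ltNge; apply/negP => x0.
have U0 : U <= 0.
  rewrite /U big_seq; apply: sumr_le0 => a sa.
  apply: mulr_le0_ge0; last by rewrite invr_ge0 ltW // den0.
  have := s0 _ sa; nra.
have := mulr_ge0_le0 be0 x0; have := mulr_ge0_le0 (ltW al0) U0; move: E1; lra.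
Qed.
Lemma posrooted1 : posrooted (1 : {poly R}).
Proof. by exists [::] => //; rewrite /rootprod big_nil. Qed.

Lemma posrooted_coef0 (p : {poly R}) : posrooted p -> p.[0] = 1.
Proof.
move=> [s _ ->]; rewrite horner_rootprod big1 // => a _.
by rewrite mulr0 subr0.
Qed.

(** All complex roots are positive reals by posrooted_root; it remains to descend
from the factorization over the algebraic closure to the reals. *)
Lemma posrooted_step (p : {poly R}) (al be : R) :
    posrooted p -> 0 < al -> 0 <= be ->
  posrooted (p * (1 - be *: 'X) + al *: ('X * p^`())).
Proof.
move=> pp al0 be0; set q := _ + _.
have q0 : q.[0] = 1.
  rewrite /q hornerD hornerM hornerZ hornerM hornerX mul0r mulr0 addr0 posrooted_coef0 // mul1r.
  by rewrite -[1]/(1%:P) hornerD hornerN hornerC hornerZ hornerX mulr0 subr0.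
have [rs Eq] := closed_field_poly_normal (map_poly toC q).
set l := lead_coef _ in Eq.
have qn0 : q != 0 by apply: contra_eqN q0 => /eqP ->; rewrite horner0 eq_sym oner_eq0.
have l0 : l != 0 by rewrite lead_coef_eq0 map_poly_eq0.
have rsP z : z \in rs -> 0 < complex.Re z /\ z = (complex.Re z)%:C.
  move=> zrs; have [|x x0 ->] // := @posrooted_root p al be z pp al0 be0.
  by rewrite -/q Eq rootZ // root_prod_XsubC.
(* The leading coefficient is real because q takes the real value 1 at 0. *)
have Ers : map_poly toC q =
    map_poly toC (complex.Re l *: \prod_(z <- map (@complex.Re R) rs) ('X - z%:P)).
  have El : map_poly toC q = l *: map_poly toC (\prod_(z <- map (@complex.Re R) rs) ('X - z%:P)).
    rewrite Eq rmorph_prod big_map; congr (_ *: _).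
    apply: eq_big_seq => z /rsP[_ Ez].
    by rewrite {1}Ez rmorphB /= map_polyX map_polyC.
  suff lR : l = (complex.Re l)%:C by rewrite El {1}lR map_polyZ.
  have := congr1 (fun p => p.[0]) El; rewrite -[0 in LHS](rmorph0 toC) horner_map q0.
  rewrite hornerZ -[0 in RHS](rmorph0 toC) horner_map /=.
  set w := (\prod_(_ <- _) _).[0].
  case: (l) => a b /eqP; rewrite eq_complex /= => /andP[/eqP e1 /eqP e2].
  have : b * w = 0 by rewrite e2; ring.
  move/eqP; rewrite mulf_eq0 => /orP[/eqP -> //|/eqP w0].
  by move/eqP: e1; rewrite w0 !mulr0 subr0 oner_eq0.
move/map_poly_inj: Ers => Ers.
exists (map (fun z : R[i] => (complex.Re z)^-1) rs).
  by move=> _ /mapP[z /rsP[z0 _] ->]; rewrite invr_gt0.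
have Ep : \prod_(z <- map (@complex.Re R) rs) ('X - z%:P) =
   (\prod_(z <- rs) (- complex.Re z)) *: rootprod (map (fun z : R[i] => (complex.Re z)^-1) rs).
  elim: (rs) rsP {Eq Ers} => [|z t IH] H.
    by rewrite /rootprod !big_nil scale1r.
  rewrite !map_cons rootprod_cons !big_cons IH; last first.
    by move=> w wt; apply: H; rewrite in_cons wt orbT.
  have [z0 _] := H z (mem_head _ _).
  rewrite -scalerAr [- _ * _]mulrC -scalerA; congr (_ *: _).
  rewrite scalerAl; congr (_ * _).
  by rewrite scalerBr scalerA mulNr divff ?gt_eqF // scaleN1r opprK addrC scaleNr alg_polyC.
rewrite Ep scalerA in Ers; rewrite Ers.
have := q0; rewrite Ers hornerZ posrooted_coef0; last first.
  by eexists; [|reflexivity] => _ /mapP[z /rsP[z0 _] ->]; rewrite invr_gt0.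
by rewrite mulr1 => ->; rewrite scale1r.
Qed.

Lemma posrooted_scale (p : {poly R}) (k : R) : 0 < k -> posrooted p ->
  posrooted (p \Po (k *: 'X)).
Proof.
move=> k0 [s s0 ->]; exists (map (fun a => a * k) s).
  by move=> _ /mapP[a /s0 a0 ->]; rewrite mulr_gt0.
rewrite /rootprod rmorph_prod big_map; apply: eq_bigr => a _ /=.
by rewrite comp_polyB comp_polyC comp_polyZ comp_polyX scalerA.
Qed.
End PosRooted.

(** * Power sums *)

Definition psum (R : pzRingType) (s : seq R) (k : nat) : R := \sum_(a <- s) a ^+ k.

(** This is the coefficientwise form of P' = - P sum_a a / (1 - a X). *)
Lemma newton_rootprod (R : comNzRingType) (s : seq R) n :
  (rootprod s)`_n.+1 *+ n.+1 =
  - \sum_(m < n.+1) psum s m.+1 * (rootprod s)`_(n - m).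
Proof.
elim: s n => [|a s IH] n.
  rewrite /rootprod big_nil coef1 mul0rn big1 ?oppr0 // => i _.
  by rewrite /psum big_nil mul0r.
have Ec j : (rootprod (a :: s))`_j.+1 = (rootprod s)`_j.+1 - a * (rootprod s)`_j.
  by rewrite rootprod_cons mulrBl mul1r coefB -scalerAl coefZ coefXM.
have E0 : (rootprod (a :: s))`_0 = (rootprod s)`_0.
  by rewrite rootprod_cons mulrBl mul1r coefB -scalerAl coefZ coefXM mulr0 subr0.
(* (1 - a X) cancels against the geometric series of a. *)
have tele k : \sum_(m < k.+1) a ^+ m.+1 * (rootprod (a :: s))`_(k - m) =
    a * (rootprod s)`_k.
  elim: k => [|k IHk]; first by rewrite big_ord1 E0 expr1.
  rewrite big_ord_recl subn0 Ec expr1.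
  under eq_bigr => i _ do rewrite lift0 subSS exprS -mulrA.
  by rewrite -mulr_sumr IHk; ring.
have Ep m : psum (a :: s) m = a ^+ m + psum s m by rewrite /psum big_cons.
under eq_bigr => i _ do rewrite Ep mulrDl.
rewrite big_split /= tele Ec mulrnBl IH.
suff -> : \sum_(i < n.+1) psum s i.+1 * (rootprod (a :: s))`_(n - i) =
  \sum_(i < n.+1) psum s i.+1 * (rootprod s)`_(n - i) + a * (rootprod s)`_n *+ n.
  by rewrite mulrSr; ring.
case: n => [|n]; first by rewrite !big_ord1 E0 mulr0n addr0.
rewrite !(big_ord_recr n.+1) /= subnn E0 addrAC; congr (_ + _).
rewrite -mulrnAr IH mulrN mulr_sumr -sumrN -big_split /=; apply: eq_bigr => i _.
by rewrite subSn ?leq_ord // Ec; ring.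
Qed.

Section PowerSums.
Variable R : realFieldType.
Implicit Types (s : seq R) (A a : R).

Lemma cauchy_schwarz_seq s (w : R -> R) : {in s, forall a, 0 <= a} ->
    {in s, forall a, 0 <= w a} ->
  (\sum_(a <- s) w a * a) ^+ 2 <=
  (\sum_(a <- s) w a) * (\sum_(a <- s) w a * a ^+ 2).
Proof.
elim: s => [|a s IH] s0 w0; first by rewrite !big_nil expr0n /= mul0r.
have a0 : 0 <= a by rewrite s0 ?mem_head.
have wa0 : 0 <= w a by rewrite w0 ?mem_head.
have s0' b : b \in s -> 0 <= b by move=> bs; rewrite s0 // in_cons bs orbT.
have w0' b : b \in s -> 0 <= w b by move=> bs; rewrite w0 // in_cons bs orbT.
rewrite !big_cons; move: (IH s0' w0').
have : 0 <= \sum_(b <- s) w b.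
  by rewrite big_seq; apply: sumr_ge0 => b /w0'.
have : 0 <= \sum_(b <- s) w b * b.
  by rewrite big_seq; apply: sumr_ge0 => b bs; rewrite mulr_ge0 ?w0' ?s0'.
have : 0 <= \sum_(b <- s) w b * b ^+ 2.
  by rewrite big_seq; apply: sumr_ge0 => b bs; rewrite mulr_ge0 ?w0' ?sqr_ge0.
set P := \sum_(b <- s) w b; set Q := \sum_(b <- s) w b * b.
set S := \sum_(b <- s) _ => S0 Q0 P0 QPS.
(* The geometric mean of S and a^2 P dominates a Q. *)
have amgm : 2 * a * Q <= S + a ^+ 2 * P.
  rewrite -(ler_pXn2r (n := 2)) ?nnegrE //; last 2 first.
  - by rewrite !mulr_ge0.
  - by rewrite addr_ge0 // mulr_ge0 // sqr_ge0.
  have := sqr_ge0 (S - a ^+ 2 * P); have := ler_wpM2l (sqr_ge0 a) QPS; nra.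
have := ler_wpM2l wa0 amgm; nra.
Qed.

Lemma psum_ge0 s k : {in s, forall a, 0 <= a} -> 0 <= psum s k.
Proof. by move=> s0; rewrite /psum big_seq sumr_ge0 // => a /s0 a0; rewrite exprn_ge0. Qed.

(** Cauchy-Schwarz with weights a^k. *)
Lemma psum_logconvex s k : {in s, forall a, 0 <= a} ->
  psum s k.+1 ^+ 2 <= psum s k * psum s k.+2.
Proof.
move=> s0; have := @cauchy_schwarz_seq s (fun a => a ^+ k) s0.
rewrite /psum => H.
under eq_bigr => i _ do rewrite exprSr.
under [X in _ <= _ * X]eq_bigr => i _ do rewrite -addn2 exprD.
by apply: H => a /s0 a0; rewrite exprn_ge0.
Qed.

(** On power sums this is sum_a (A - a)^2 a^k (sqdiff_psum): it measures how far
the sequence is from being geometric of ratio A, and it stays a moment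
sequence for every A, in particular for a limit of largest elements. *)
Definition sqdiff (sigma : nat -> R) A k := A ^+ 2 * sigma k - 2 * A * sigma k.+1 + sigma k.+2.

Lemma sqdiff_psum s A k : sqdiff (psum s) A k = \sum_(a <- s) (A - a) ^+ 2 * a ^+ k.
Proof.
rewrite /sqdiff /psum !mulr_sumr -sumrB -big_split /=; apply: eq_bigr => a _.
by rewrite !exprS; ring.
Qed.

Lemma sqdiff_logconvex s A k : {in s, forall a, 0 <= a} ->
  sqdiff (psum s) A k.+1 ^+ 2 <= sqdiff (psum s) A k * sqdiff (psum s) A k.+2.
Proof.
move=> s0; have := @cauchy_schwarz_seq s (fun a => (A - a) ^+ 2 * a ^+ k) s0.
rewrite !sqdiff_psum => H.
under eq_bigr => i _ do rewrite [_ ^+ k.+1]exprSr mulrA.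
under [X in _ <= _ * X]eq_bigr => i _ do rewrite -(addn2 k) exprD mulrA.
by apply: H => a /s0 a0; rewrite mulr_ge0 ?sqr_ge0 // exprn_ge0.
Qed.

Definition maxs s : R := \big[Num.max/0]_(a <- s) a.

Lemma maxs_ge0 s : 0 <= maxs s.
Proof. by rewrite /maxs; elim/big_rec : _ => // a x _ x0; rewrite le_max x0 orbT. Qed.

Lemma le_maxs s a : a \in s -> a <= maxs s.
Proof.
rewrite /maxs; elim: s => // b s IH; rewrite in_cons big_cons le_max.
by move=> /orP[/eqP -> |/IH ->]; rewrite ?lexx ?orbT.
Qed.

Lemma maxs_mem s : 0 < maxs s -> maxs s \in s.
Proof.
rewrite /maxs; elim: s => [|b s IH]; first by rewrite big_nil ltxx.
rewrite big_cons in_cons maxEle; case: ifP => [_ /IH ->|_ _]; rewrite ?eqxx ?orbT //.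
Qed.

Lemma psumS_le s k : {in s, forall a, 0 <= a} -> psum s k.+1 <= maxs s * psum s k.
Proof.
move=> s0; rewrite /psum mulr_sumr big_seq [leRHS]big_seq; apply: ler_sum => a sa.
by rewrite exprS ler_wpM2r ?exprn_ge0 ?s0 ?le_maxs.
Qed.

Lemma maxs_le_psum s k : {in s, forall a, 0 <= a} -> maxs s ^+ k.+1 <= psum s k.+1.
Proof.
move=> s0; have [m0|/negbTE m0] := boolP (0 < maxs s); last first.
  have -> : maxs s = 0 by move: (maxs_ge0 s); rewrite le_eqVlt m0 orbF => /eqP.
  by rewrite exprS mul0r psum_ge0.
have ms := maxs_mem m0; rewrite /psum (big_rem _ ms) /= lerDl big_seq.
by apply: sumr_ge0 => a /mem_rem /s0 a0; rewrite exprn_ge0.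
Qed.

(** Both sides are compared with the largest element: it is at least the ratio of
consecutive power sums, and its powers are at most the power sums. *)
Lemma psumS_expr_le s j k : {in s, forall a, 0 <= a} ->
  psum s j.+1 ^+ k.+1 <= psum s k.+1 * psum s j ^+ k.+1.
Proof.
move=> s0; apply: (@le_trans _ _ ((maxs s * psum s j) ^+ k.+1)).
  by rewrite lerXn2r ?nnegrE ?psumS_le ?psum_ge0 // mulr_ge0 ?maxs_ge0 ?psum_ge0.
by rewrite exprMn ler_wpM2r ?maxs_le_psum // exprn_ge0 ?psum_ge0.
Qed.
End PowerSums.

(** * The generating function of the sigma_n *)

Section Formal.
Variables (R : realType) (nu : R).
Hypothesis hnu : -1 < nu.

Lemma pochhammer_gt0 (x : R) n : 0 < x -> 0 < pochhammer x n.
Proof. by move=> x0; apply: prodr_gt0 => i _; rewrite ltr_wpDr. Qed.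

Lemma pochhammerS (x : R) n : pochhammer x n.+1 = pochhammer x n * (x + n%:R).
Proof. by rewrite /pochhammer big_ord_recr. Qed.

Let nu1 : 0 < nu + 1. Proof. by move: hnu; lra. Qed.

Lemma pochhammer_nu_neq0 n : pochhammer (nu + 1) n != 0.
Proof. by rewrite gt_eqF // pochhammer_gt0. Qed.

Lemma mu_coef0 : mu_coef nu 0 = 1.
Proof. by rewrite /mu_coef /pochhammer big_ord0 !expr0 fact0 !mulr1 divr1. Qed.

Lemma mu_coef_sign n : 0 < (-1) ^+ n * mu_coef nu n.
Proof.
rewrite /mu_coef !mulrA -exprMn mulrNN mulr1 expr1n mul1r divr_gt0 //.
by rewrite !mulr_gt0 ?exprn_gt0 ?pochhammer_gt0 // ltr0n fact_gt0.
Qed.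

Lemma mu_coef_neq0 n : mu_coef nu n != 0.
Proof. by apply: contraTneq (mu_coef_sign n) => ->; rewrite mulr0 ltxx. Qed.

Lemma lambda_coefE n : lambda_coef nu n = n.+1%:R * mu_coef nu n.+1.
Proof.
rewrite /lambda_coef /mu_coef mulrA; congr (_ / _); last first.
  by rewrite (_ : (2 * n + 2 = 2 * n.+1)%N) //; lia.
rewrite mulrCA; congr (_ * _); rewrite -natrM; congr (_%:R).
by rewrite mulnA (_ : (2 * n.+1 + 1 = 2 * n + 3)%N) //; lia.
Qed.

Lemma coef_unit_series (f : nat -> R) N j : (j <= N)%N ->
  (1 + \sum_(1 <= k < N.+1) f k *: 'X^k)`_j = if j == 0%N then 1 else f j.
Proof.
move=> jN; rewrite coefD coef1 coef_sum.
case: j jN => [|j] jN /=.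
  rewrite big_nat_cond big1 ?addr0 // => k /andP[/andP[k0 _] _].
  by rewrite coefZ coefXn ltn_eqF ?mulr0.
rewrite add0r (bigD1_seq j.+1) ?mem_index_iota ?iota_uniq //=.
rewrite coefZ coefXn eqxx mulr1 big1 ?addr0 // => k kj.
by rewrite coefZ coefXn eq_sym (negPf kj) mulr0.
Qed.

(** The pi_m are the coefficients of 1 / Delta, expanded as a geometric series in
1 - Delta = - mu_1 z (1 + sum_k f_k z^k).  Everything is done with polynomials
truncated at degree n. *)
Lemma pi_mu_inverse n :
  \sum_(m < n.+1) pi_coef nu m * mu_coef nu (n - m) = (n == 0%N)%:R.
Proof.
pose G := 1 + \sum_(1 <= k < n.+1) f_coef nu k *: 'X^k : {poly R}.
pose U := - mu_coef nu 1 *: ('X * G).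
pose S := \sum_(p < n.+1) U ^+ p.
have US : S * (1 - U) = 1 - U ^+ n.+1.
  by rewrite -[RHS]opprB subrX1 -mulNr opprB mulrC.
have UE p j : (U ^+ p)`_j =
    (- mu_coef nu 1) ^+ p * (if (j < p)%N then 0 else (G ^+ p)`_(j - p)).
  by rewrite /U exprZn coefZ exprMn coefXnM.
have SE j : (j <= n)%N -> S`_j = pi_coef nu j.
  move=> jn; rewrite /S coef_sum /pi_coef; case: j jn => [|j] jn /=.
    rewrite big_ord_recl expr0 coef1 big1 ?addr0 // => i _.
    by rewrite UE lift0 mulr0.
  rewrite big_ord_recl expr0 coef1 add0r big_add1 /= big_mkord.
  rewrite (big_ord_widen n (fun i => (-1) ^+ i.+1 * mu_coef nu 1 ^+ i.+1 *
             potential_poly i.+1 (j.+1 - i.+1) (f_coef nu))) // [RHS]big_mkcond /=.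
  apply: eq_bigr => i _; rewrite UE /bump leq0n add1n ltnS [in RHS]ltnS.
  case: ltnP => ij; first by rewrite mulr0.
  by rewrite potential_polyE ?(leq_trans (leq_subr _ _)) // -exprMn mulN1r.
have ME j : (j <= n)%N -> (1 - U)`_j = mu_coef nu j.
  move=> jn; rewrite coefB coef1 /U coefZ coefXM; case: j jn => [|j] jn /=.
    by rewrite mulr0 subr0 mu_coef0.
  rewrite coef_unit_series ?(ltnW jn) // sub0r mulNr opprK.
  case: j jn => [|j] _ /=; first by rewrite mulr1.
  by rewrite /f_coef mulrC divfK ?mu_coef_neq0.
have := congr1 (fun p : {poly R} => p`_n) US; rewrite /= coefM coefB coef1 UE ltnSn mulr0 subr0.
move=> <-; apply: eq_bigr => i _.
by rewrite SE ?ME ?leq_subr // -ltnS.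
Qed.

(** Since lambda_n = (n+1) mu_(n+1) are the coefficients of Delta', the definition
of sigma reads - S = Delta' / Delta with S = sum_n sigma_(n+1) z^n; this is
Delta' = - S Delta. *)
Lemma sigma_newton (sigma : nat -> R) :
  (forall n, - sigma n.+1 =
     \sum_(0 <= m < n.+1) pi_coef nu m * lambda_coef nu (n - m)) ->
  forall n, n.+1%:R * mu_coef nu n.+1 =
    - \sum_(m < n.+1) sigma m.+1 * mu_coef nu (n - m).
Proof.
move=> hs n.
pose P := \poly_(i < n.+1) pi_coef nu i.
pose L := \poly_(i < n.+1) lambda_coef nu i.
pose M := \poly_(i < n.+1) mu_coef nu i.
have co (g h : nat -> R) j : (j <= n)%N ->
    (\poly_(i < n.+1) g i * \poly_(i < n.+1) h i)`_j = \sum_(m < j.+1) g m * h (j - m)%N.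
  move=> jn; rewrite coefM; apply: eq_bigr => i _.
  have ij : (i <= j)%N by rewrite -ltnS.
  by rewrite !coef_poly !ltnS (leq_trans ij) // (leq_trans (leq_subr _ _)).
have -> : - \sum_(m < n.+1) sigma m.+1 * mu_coef nu (n - m) = ((P * L) * M)`_n.
  rewrite coefM -sumrN; apply: eq_bigr => i _.
  have ij : (i <= n)%N by rewrite -ltnS.
  rewrite -mulNr hs big_mkord co // coef_poly ltnS leq_subr //.
rewrite mulrAC coefM big_ord_recl subn0 /=.
rewrite co // pi_mu_inverse eqxx mul1r coef_poly ltnSn lambda_coefE big1 ?addr0 //.
by move=> i _; rewrite /bump leq0n add1n co ?pi_mu_inverse /= ?mul0r.
Qed.
End Formal.

(** * Modulus and series of complex numbers *)

Section Cabs.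
Variable R : realType.
Implicit Types (z w : R[i]) (x y : R).

(** The modulus as a real number, so that estimates can be made in R. *)
Definition cabs z : R := complex.Re `|z|.

Lemma cabsE z : `|z| = (cabs z)%:C.
Proof. by rewrite /cabs normc_def. Qed.

Lemma cabs_ge0 z : 0 <= cabs z.
Proof. by rewrite -lecR -cabsE normr_ge0. Qed.

Lemma cabsM z w : cabs (z * w) = cabs z * cabs w.
Proof. by apply: complexI; rewrite rmorphM -!cabsE normrM. Qed.

Lemma cabsX z n : cabs (z ^+ n) = cabs z ^+ n.
Proof. by apply: complexI; rewrite rmorphXn -!cabsE normrX. Qed.

Lemma cabsN z : cabs (- z) = cabs z.
Proof. by apply: complexI; rewrite -!cabsE normrN. Qed.

Lemma cabsD z w : cabs (z + w) <= cabs z + cabs w.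
Proof. by rewrite -lecR rmorphD /= -!cabsE ler_normD. Qed.

Lemma cabsB z w : cabs (z - w) <= cabs z + cabs w.
Proof. by rewrite -(cabsN w) cabsD. Qed.

Lemma cabs_distC z w : cabs (z - w) = cabs (w - z).
Proof. by rewrite -cabsN opprB. Qed.

Lemma cabs_real x : cabs x%:C = `|x|.
Proof. by rewrite /cabs normc_def /= expr0n addr0 sqrtr_sqr. Qed.

Lemma cabs0 : cabs 0 = 0. Proof. by rewrite /cabs normr0. Qed.

Lemma cabs_eq0 z : (cabs z == 0) = (z == 0).
Proof. by rewrite -(normr_eq0 z) cabsE; apply/eqP/eqP => [->|[]]. Qed.

Lemma cabsV z : cabs z^-1 = (cabs z)^-1.
Proof. by apply: complexI; rewrite fmorphV -!cabsE normfV. Qed.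

Lemma cabs_sum (u : nat -> R[i]) m n :
  cabs (\sum_(m <= i < n) u i) <= \sum_(m <= i < n) cabs (u i).
Proof.
elim/big_ind2 : _ => [|a x b y ax by_|//]; first by rewrite cabs0.
by rewrite (le_trans (cabsD _ _)) // lerD.
Qed.

Lemma cabs_dist_le z w : `|cabs z - cabs w| <= cabs (z - w).
Proof.
rewrite ler_norml.
have := cabsD (z - w) w; rewrite subrK => h1.
have := cabsD (w - z) z; rewrite subrK cabs_distC => h2.
by apply/andP; split; lra.
Qed.

Lemma Re_le_cabs z : `|complex.Re z| <= cabs z.
Proof.
case: z => x y; rewrite /cabs normc_def /= -sqrtr_sqr ler_wsqrtr //.
by rewrite lerDl sqr_ge0.
Qed.

Lemma Im_le_cabs z : `|complex.Im z| <= cabs z.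
Proof.
case: z => x y; rewrite /cabs normc_def /= -sqrtr_sqr ler_wsqrtr //.
by rewrite lerDr sqr_ge0.
Qed.

Lemma cabs_le z : cabs z <= `|complex.Re z| + `|complex.Im z|.
Proof.
case: z => x y /=; have -> : x +i* y = x%:C + 'i%C * y%:C.
  by apply/eqP; rewrite eq_complex /=; apply/andP; split; apply/eqP; ring.
rewrite (le_trans (cabsD _ _)) // cabsM !cabs_real.
by rewrite [cabs 'i%C]/cabs normc_def /= expr0n /= expr1n add0r sqrtr1 mul1r.
Qed.

(** Convergence expressed by a real sequence; it implies convergence for the norm
topology of the complex numbers (ccvg_topology). *)
Definition ccvg (u : nat -> R[i]) (l : R[i]) := (fun n => cabs (l - u n)) @ \oo --> (0 : R).

Lemma ccvgP (u : nat -> R[i]) l :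
  (forall e, 0 < e -> \forall n \near \oo, cabs (l - u n) <= e) -> ccvg u l.
Proof.
move=> H; apply/cvgrPdist_le => e e0; near=> n.
by rewrite sub0r normrN ger0_norm ?cabs_ge0 //; near: n; apply: H.
Unshelve. all: by end_near. Qed.

Lemma ccvg_near (u : nat -> R[i]) l e : ccvg u l -> 0 < e ->
  \forall n \near \oo, cabs (l - u n) <= e.
Proof.
move=> /cvgrPdist_le /(_ e) H /H; apply: filterS => n.
by rewrite sub0r normrN ger0_norm ?cabs_ge0.
Qed.

Lemma ccvg_topology (u : nat -> R[i]^o) (l : R[i]^o) : ccvg u l -> u @ \oo --> l.
Proof.
move=> ul; apply/cvgrPdist_le => e e0.
have eE : e = (complex.Re e)%:C by rewrite RRe_real // gtr0_real.
have e0' : 0 < complex.Re e by rewrite -ltcR -eE.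
have := ccvg_near ul e0'; apply: filterS => n.
by rewrite cabsE eE lecR.
Qed.

Lemma csum_unique (u : nat -> R[i]) l :
  ccvg (fun n => \sum_(0 <= i < n) u i) l -> csum u = l.
Proof.
move=> ul; have H := ccvg_topology ul.
by rewrite /csum; apply: cvg_lim H; exact: norm_hausdorff.
Qed.

Lemma geometric_tail (M : R) m n : 0 <= M ->
  \sum_(m <= i < n) (M / 2 ^+ i) <= 2 * M / 2 ^+ m.
Proof.
move=> M0; have [nm|mn] := leqP n m; first by rewrite big_geq // divr_ge0 ?mulr_ge0 ?exprn_ge0.
suff : \sum_(m <= i < n) (M / 2 ^+ i) + 2 * M / 2 ^+ n = 2 * M / 2 ^+ m.
  by move=> <-; rewrite lerDl divr_ge0 ?mulr_ge0 ?exprn_ge0.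
rewrite -(subnKC (ltnW mn)); elim: (n - m)%N => [|k IH].
  by rewrite addn0 big_geq // add0r.
rewrite addnS big_nat_recr ?leq_addr //= -[RHS]IH -addrA; congr (_ + _).
by rewrite exprS; field; rewrite expf_neq0.
Qed.

Lemma geometric_small (M e : R) : 0 < e -> \forall k \near \oo, 2 * M / 2 ^+ k <= e.
Proof.
move=> e0; have H : geometric (2 * M) (2^-1) @ \oo --> (0 : R).
  by apply: cvg_geometric; rewrite ger0_norm; lra.
move/cvgrPdist_le : H => /(_ _ e0); apply: filterS => k.
rewrite /geometric /= sub0r normrN exprVn => h; exact: le_trans (ler_norm _) h.
Qed.

(** The real and imaginary parts converge absolutely, by comparison with a
geometric series. *)
Lemma csum_tail (u : nat -> R[i]) (M : R) :
  (forall n, cabs (u n) <= M / 2 ^+ n) ->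
  forall K, cabs (csum u - \sum_(0 <= i < K) u i) <= 2 * M / 2 ^+ K.
Proof.
move=> uM; have M0 : 0 <= M.
  by have := le_trans (cabs_ge0 _) (uM 0%N); rewrite expr0 divr1.
have cv (f : R[i] -> R) : (forall z, `|f z| <= cabs z) -> cvgn (series (fun n => f (u n))).
  move=> fle; apply: normed_cvg.
  apply: (@series_le_cvg _ _ (geometric M (2^-1))) => [n|n|n|].
  - exact: normr_ge0.
  - by rewrite /geometric /= mulr_ge0 ?exprn_ge0.
  - by rewrite /geometric /= exprVn (le_trans (fle _)).
  - by apply: is_cvg_geometric_series; rewrite ger0_norm; lra.
have cvR := cv _ Re_le_cabs; have cvI := cv _ Im_le_cabs.
pose l := limn (series (fun n => complex.Re (u n))) +i* limn (series (fun n => complex.Im (u n))).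
have ul : ccvg (fun n => \sum_(0 <= i < n) u i) l.
  apply: ccvgP => e e0.
  have e20 : 0 < e / 2 by lra.
  move/cvgrPdist_le : cvR => /(_ _ e20) H1; move/cvgrPdist_le : cvI => /(_ _ e20) H2.
  near=> n; apply: le_trans (cabs_le _) _.
  have sE k : \sum_(0 <= i < k) u i = 
     series (fun n => complex.Re (u n)) k +i* series (fun n => complex.Im (u n)) k.
    rewrite /series /=; elim: k => [|k IH]; first by rewrite !big_geq.
    rewrite !big_nat_recr //= IH; case: (u k) => //.
  rewrite sE /= (splitr e); apply: lerD.
    by near: n.
  by near: n.
rewrite (csum_unique ul) => K; apply/ler_addgt0Pr => e e0.
near \oo => n.
have -> : l - \sum_(0 <= i < K) u i =
   (l - \sum_(0 <= i < n) u i) + \sum_(K <= i < n) u i.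
  rewrite (@big_cat_nat _ _ _ K 0 n) //=; first by rewrite opprD addrA subrK.
  by near: n; exists K.
rewrite (le_trans (cabsD _ _)) // addrC lerD //.
  apply: le_trans (cabs_sum _ _ _) _.
  apply: le_trans (geometric_tail _ _ M0); exact: ler_sum.
by near: n; exact: ccvg_near.
Unshelve. all: by end_near. Qed.
End Cabs.

(** * Power series with infinite radius of convergence *)

Lemma taylor2_recurrence (K : comNzRingType) (z w : K) n :
  (z + w) ^+ n.+1 - z ^+ n.+1 - n.+1%:R * w * z ^+ n =
  (z + w) * ((z + w) ^+ n - z ^+ n - n%:R * w * z ^+ n.-1) +
  w ^+ 2 * (n%:R * z ^+ n.-1).
Proof.
case: n => [|n] /=; first by ring.
rewrite ?(exprS _ n.+1) ?(exprS _ n) -?natr1.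
move: (n%:R) (z ^+ n) ((z + w) ^+ n) => a b c; ring.
Qed.

Section PowerSeries.
Variable R : realType.
Implicit Types (z w : R[i]) (x y : R) (c d : nat -> R).

(** Boundedness for every radius: it is stable under the operations used below,
and it yields geometric domination by passing to the double radius. *)
Definition entire c := forall rho, 0 <= rho -> exists M, forall n, `|c n| * rho ^+ n <= M.

Definition ptrunc c K z : R[i] := \sum_(0 <= n < K) (c n)%:C * z ^+ n.

Definition pser c z : R[i] := csum (fun n => (c n)%:C * z ^+ n).

Definition shiftderiv c n : R := n.+1%:R * c n.+1.

(** Absorbs the factor n that differentiation creates into a larger radius. *)
Lemma mulrn_expr_le (x : R) n : 0 <= x -> n%:R * x ^+ n.-1 <= (x + 2) ^+ n.
Proof.
move=> x0; elim: n => [|n IH]; first by rewrite mul0r expr0.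
have h : x ^+ n <= (x + 2) ^+ n by apply: lerXn2r; rewrite ?nnegrE; lra.
have {}IH : n%:R * x ^+ n <= (x + 2) ^+ n * x.
  case: n IH {h} => [|n] IH; first by rewrite mul0r expr0 mul1r.
  by rewrite exprSr mulrA ler_wpM2r.
have p0 : 0 <= (x + 2) ^+ n by rewrite exprn_ge0 //; lra.
rewrite -natr1 /= exprSr; lra.
Qed.

Lemma taylor2_monomial z w n : cabs w <= 1 ->
  cabs ((z + w) ^+ n - z ^+ n - n%:R * w * z ^+ n.-1) <=
  cabs w ^+ 2 * (cabs z + 2) ^+ n.
Proof.
move=> w1; elim: n => [|n IH].
  by rewrite !expr0 subrr !mul0r subr0 cabs0 mulr1 sqr_ge0.
rewrite taylor2_recurrence.
apply: le_trans (cabsD _ _) _; rewrite !cabsM !cabsX.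
have -> : cabs (n%:R : R[i]) = n%:R.
  by rewrite -(rmorph_nat (real_complex R)) cabs_real ger0_norm.
have zw : cabs (z + w) <= cabs z + 1 by apply: le_trans (cabsD _ _) _; lra.
have h1 : cabs (z + w) * cabs ((z + w) ^+ n - z ^+ n - n%:R * w * z ^+ n.-1) <=
   (cabs z + 1) * (cabs w ^+ 2 * (cabs z + 2) ^+ n).
  by apply: ler_pM => //; exact: cabs_ge0.
have h2 : cabs w ^+ 2 * (n%:R * cabs z ^+ n.-1) <= cabs w ^+ 2 * (cabs z + 2) ^+ n.
  by rewrite ler_wpM2l ?sqr_ge0 // mulrn_expr_le ?cabs_ge0.
by apply: le_trans (lerD h1 h2) _; rewrite (exprS _ n); lra.
Qed.

Lemma entire_shiftderiv c : entire c -> entire (shiftderiv c).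
Proof.
move=> ec rho rho0; have [|M HM] := ec (rho + 2); first by lra.
exists M => n; apply: le_trans (HM n.+1).
rewrite /shiftderiv normrM ger0_norm // mulrAC mulrC ler_wpM2l //.
exact: (@mulrn_expr_le _ n.+1).
Qed.

Lemma entire_le c d : (forall n, `|d n| <= `|c n|) -> entire c -> entire d.
Proof.
move=> dc ec rho rho0; have [M HM] := ec _ rho0; exists M => n.
by apply: le_trans (HM n); rewrite ler_wpM2r ?exprn_ge0.
Qed.

Lemma pser_tail c z M rho K : cabs z <= rho ->
    (forall n, `|c n| * (2 * rho) ^+ n <= M) ->
  cabs (pser c z - ptrunc c K z) <= 2 * M / 2 ^+ K.
Proof.
move=> zr HM; apply: csum_tail => n; rewrite cabsM cabs_real cabsX.
rewrite ler_pdivlMr ?exprn_gt0 //; apply: le_trans (HM n).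
rewrite -mulrA ler_wpM2l // -exprMn mulrC lerXn2r ?nnegrE ?mulr_ge0 ?cabs_ge0 //.
- by apply: le_trans zr; exact: cabs_ge0.
- by rewrite ler_wpM2l.
Qed.

Lemma pser_ccvg c z : entire c -> ccvg (fun K => ptrunc c K z) (pser c z).
Proof.
move=> ec; have [|M HM] := ec (2 * cabs z); first by rewrite mulr_ge0 ?cabs_ge0.
apply: ccvgP => e e0; apply: filterS (geometric_small M e0) => K.
exact: le_trans (pser_tail _ (lexx _) HM).
Qed.

Lemma ptrunc_poly (p : {poly R}) z K : (size p <= K)%N ->
  ptrunc (fun n => p`_n) K z = (map_poly (real_complex R) p).[z].
Proof.
move=> pK; rewrite /ptrunc (@horner_coef_wide _ K) ?size_map_poly // big_mkord.
by apply: eq_bigr => i _; rewrite coef_map.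
Qed.

Lemma pser_poly (p : {poly R}) z :
  pser (fun n => p`_n) z = (map_poly (real_complex R) p).[z].
Proof.
apply: csum_unique; apply: ccvgP => e e0; exists (size p) => // n /= pn.
by rewrite -(ptrunc_poly _ pn) subrr cabs0 ltW.
Qed.

(** Dominated convergence for power series: cut off a uniformly small tail, and
use termwise convergence on the finite rest. *)
Lemma tannery c (d : nat -> nat -> R) z : entire c ->
    (forall N n, `|d N n| <= `|c n|) ->
    (forall n, (fun N => d N n) @ \oo --> c n) ->
  ccvg (fun N => pser (d N) z) (pser c z).
Proof.
move=> ec dc dcvg; have [|M HM] := ec (2 * cabs z); first by rewrite mulr_ge0 ?cabs_ge0.
have HMd N n : `|d N n| * (2 * cabs z) ^+ n <= M.
  by apply: le_trans (HM n); rewrite ler_wpM2r ?exprn_ge0 ?mulr_ge0 ?cabs_ge0.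
apply: ccvgP => e e0; have e30 : 0 < e / 3 by lra.
near \oo => K.
have hK : 2 * M / 2 ^+ K <= e / 3 by near: K; exact: geometric_small.
have cvs : (fun N => \sum_(0 <= n < K) `|c n - d N n| * cabs z ^+ n) @ \oo --> (0 : R).
  elim: (K) => [|k IH].
    by under eq_fun do rewrite big_geq //; exact: cvg_cst.
  under eq_fun do rewrite big_nat_recr //=.
  have dk : (fun N => c k - d N k) @ \oo --> (0 : R).
    by rewrite -(subrr (c k)); apply: cvgB => //; exact: cvg_cst.
  have := cvgD IH (cvgM (cvg_norm dk) (cvg_cst (cabs z ^+ k))).
  by rewrite normr0 mul0r addr0; apply.
move/cvgrPdist_le : cvs => /(_ _ e30); apply: filterS => N.
rewrite sub0r normrN ger0_norm; last first.
  by apply: sumr_ge0 => i _; rewrite mulr_ge0 ?exprn_ge0 ?cabs_ge0.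
move=> hN.
have -> : pser c z - pser (d N) z = (pser c z - ptrunc c K z) +
   (ptrunc c K z - ptrunc (d N) K z) + (ptrunc (d N) K z - pser (d N) z).
  by ring.
have -> : e = e / 3 + e / 3 + e / 3 by lra.
apply: le_trans (cabsD _ _) _; apply: lerD; last first.
  by rewrite cabs_distC; apply: le_trans (pser_tail _ (lexx _) (HMd N)) hK.
apply: le_trans (cabsD _ _) _; apply: lerD.
  by apply: le_trans (pser_tail _ (lexx _) HM) hK.
apply: le_trans hN; rewrite /ptrunc -sumrB; apply: le_trans (cabs_sum _ _ _) _.
by apply: ler_sum => i _; rewrite -mulrBl -rmorphB cabsM cabs_real cabsX.
Unshelve. all: by end_near. Qed.

(** Summing the second order estimates of the monomials gives a remainder that is
quadratic in w, which contains the termwise differentiability. *)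
Lemma pser_taylor2 c z : entire c -> exists M, forall w, cabs w <= 1 ->
  cabs (pser c (z + w) - pser c z - w * pser (shiftderiv c) z) <= M * cabs w ^+ 2.
Proof.
move=> ec; have [|M HM] := ec (2 * (cabs z + 2)).
  by rewrite mulr_ge0 // addr_ge0 // cabs_ge0.
have M0 : 0 <= M by apply: le_trans (HM 0%N); rewrite expr0 mulr1.
have tr w K : cabs w <= 1 ->
   cabs (ptrunc c K.+1 (z + w) - ptrunc c K.+1 z - w * ptrunc (shiftderiv c) K z)
   <= 2 * M * cabs w ^+ 2.
  move=> w1.
  have -> : w * ptrunc (shiftderiv c) K z =
     \sum_(0 <= n < K.+1) (c n)%:C * (n%:R * w * z ^+ n.-1).
    rewrite big_nat_recl // mul0r mul0r mulr0 add0r /ptrunc mulr_sumr.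
    apply: eq_bigr => n _; rewrite /shiftderiv rmorphM rmorph_nat /=; ring.
  rewrite /ptrunc -!sumrB; apply: le_trans (cabs_sum _ _ _) _.
  have := geometric_tail 0 K.+1 M0; rewrite expr0 divr1 => h.
  apply: le_trans (ler_wpM2r (sqr_ge0 (cabs w)) h); rewrite mulr_suml.
  apply: ler_sum => n _; rewrite -!mulrBr cabsM cabs_real.
  apply: le_trans (ler_wpM2l (normr_ge0 _) (taylor2_monomial z n w1)) _.
  rewrite mulrCA mulrC ler_wpM2r ?sqr_ge0 // ler_pdivlMr ?exprn_gt0 //.
  by apply: le_trans (HM n); rewrite -mulrA -exprMn [_ * 2]mulrC.
exists (2 * M) => w w1; apply/ler_addgt0Pr => e e0.
have e30 : 0 < e / 3 by lra.
have nearS (P : nat -> Prop) : (\forall n \near \oo, P n) -> \forall n \near \oo, P n.+1.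
  by case=> N _ HN; exists N => // n /= Nn; apply: HN; exact: leqW.
have n1 := nearS _ (ccvg_near (pser_ccvg (z + w) ec) e30).
have n2 := nearS _ (ccvg_near (pser_ccvg z ec) e30).
near \oo => K.
have h1 : cabs (pser c (z + w) - ptrunc c K.+1 (z + w)) <= e / 3.
  by near: K.
have h2 : cabs (pser c z - ptrunc c K.+1 z) <= e / 3.
  by near: K.
have h3 : cabs (pser (shiftderiv c) z - ptrunc (shiftderiv c) K z) <= e / 3.
  by near: K; exact: ccvg_near (pser_ccvg _ (entire_shiftderiv ec)) e30.
have h4 := tr w K w1.
have -> : pser c (z + w) - pser c z - w * pser (shiftderiv c) z =
  (ptrunc c K.+1 (z + w) - ptrunc c K.+1 z - w * ptrunc (shiftderiv c) K z)
  + ((pser c (z + w) - ptrunc c K.+1 (z + w)) +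
     ((ptrunc c K.+1 z - pser c z) +
     w * (ptrunc (shiftderiv c) K z - pser (shiftderiv c) z))).
  by ring.
apply: le_trans (cabsD _ _) (lerD h4 _).
apply: le_trans (cabsD _ _) _.
have -> : e = e / 3 + (e / 3 + e / 3) by lra.
apply: lerD => //; apply: le_trans (cabsD _ _) (lerD _ _).
  by rewrite cabs_distC.
rewrite cabsM cabs_distC -[leRHS]mul1r; apply: ler_pM => //; exact: cabs_ge0.
Unshelve. all: by end_near. Qed.

Lemma pser_deriv c z : entire c -> cderiv (pser c) z = pser (shiftderiv c) z.
Proof.
move=> ec; have [M HM] := pser_taylor2 z ec.
rewrite /cderiv /derive1.
have hd : hausdorff_space (R[i]^o : normedModType R[i]) by exact: norm_hausdorff.
apply: (cvg_lim hd).
apply/cvgrPdist_le => e e0.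
have eE : e = (complex.Re e)%:C by rewrite RRe_real // gtr0_real.
set e' := complex.Re e in eE.
have e0' : 0 < e' by rewrite -ltcR -eE.
have M1 : 0 < `|M| + 1 by rewrite ltr_wpDl.
pose del : R := Num.min 1 (e' / (`|M| + 1)).
have del0 : 0 < del by rewrite lt_min ltr01 divr_gt0.
near=> h.
have hdel : cabs h <= del.
  rewrite -lecR -cabsE; apply: ltW; near: h; apply: dnbhs0_lt.
  by rewrite ltcR.
have h0 : h != 0 by near: h; exact: nbhs_dnbhs_neq.
have ch0 : 0 < cabs h by rewrite lt_def cabs_ge0 cabs_eq0 h0.
have h1 : cabs h <= 1 by apply: le_trans hdel _; rewrite ge_min lexx.
have h2 : cabs h * (`|M| + 1) <= e'.
  by rewrite -ler_pdivlMr //; apply: le_trans hdel _; rewrite ge_min lexx orbT.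
rewrite cabsE eE lecR.
have -> : pser (shiftderiv c) z - h^-1 *: (pser c (h + z) - pser c z) =
   - h^-1 * (pser c (z + h) - pser c z - h * pser (shiftderiv c) z).
  rewrite [h + z]addrC -[_ *: _]/(h^-1 * _); field.
  exact: h0.
rewrite cabsM cabsN cabsV mulrC ler_pdivrMr //.
apply: le_trans (HM h h1) _.
have := ler_norm M; have := cabs_ge0 h; nra.
Unshelve. all: by end_near. Qed.

End PowerSeries.

(** * Limits of power sums *)

Section SequenceLimits.
Variable R : realType.

Lemma cvg_exprn (u : nat -> R) (l : R) k : u @ \oo --> l -> (fun n => u n ^+ k) @ \oo --> l ^+ k.
Proof.
move=> ul; elim: k => [|k IH]; first by under eq_fun do rewrite expr0; exact: cvg_cst.
by under eq_fun do rewrite exprS; rewrite exprS; exact: cvgM.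
Qed.

Lemma cvg_ord_sum (u : nat -> nat -> R) (l : nat -> R) n :
    (forall m : 'I_n, (u m : nat -> R) @ \oo --> l m) ->
  (fun N => \sum_(m < n) u m N) @ \oo --> \sum_(m < n) l m.
Proof.
elim: n => [|n IH] H.
  by under eq_fun do rewrite big_ord0; rewrite big_ord0; exact: cvg_cst.
under eq_fun do rewrite big_ord_recr /=; rewrite big_ord_recr /=.
apply: cvgD; last exact: (H ord_max).
by apply: IH => m; exact: (H (widen_ord (leqnSn n) m)).
Qed.

(** By Newton's identities the power sums are polynomials in the coefficients, the
same polynomials that give sigma from c. *)
Lemma cvg_psum (s : nat -> seq R) (c sigma : nat -> R) :
    (forall n, (fun N => (rootprod (s N))`_n) @ \oo --> c n) ->
    (forall n, n.+1%:R * c n.+1 = - \sum_(m < n.+1) sigma m.+1 * c (n - m)%N) ->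
  forall k, (fun N => psum (s N) k.+1) @ \oo --> sigma k.+1.
Proof.
move=> cc hsg.
have p0 N : (rootprod (s N))`_0 = 1.
  rewrite -horner_coef0 horner_rootprod big1 // => a _.
  by rewrite mulr0 subr0.
have c0 : c 0%N = 1.
  have h : (fun _ : nat => 1) @ \oo --> c 0%N by have := cc 0%N; under eq_fun do rewrite p0.
  have hd : hausdorff_space R by exact: norm_hausdorff.
  by rewrite -(cvg_lim hd h) lim_cst.
elim/ltn_ind => k IH.
have E N : psum (s N) k.+1 = - (k.+1%:R * (rootprod (s N))`_k.+1) -
     \sum_(m < k) psum (s N) m.+1 * (rootprod (s N))`_(k - m).
  by rewrite mulr_natl newton_rootprod big_ord_recr /= subnn p0; ring.
have -> : sigma k.+1 = - (k.+1%:R * c k.+1) - \sum_(m < k) sigma m.+1 * c (k - m)%N.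
  by rewrite hsg big_ord_recr /= subnn c0; ring.
under eq_fun do rewrite E; apply: cvgB.
  by apply: cvgN; apply: cvgM; [exact: cvg_cst|exact: cc].
apply: (@cvg_ord_sum (fun m N => psum (s N) m.+1 * (rootprod (s N))`_(k - m))
         (fun m => sigma m.+1 * c (k - m)%N)) => m.
by apply: cvgM; [exact: IH|exact: cc].
Qed.
End SequenceLimits.

Section LimitMoments.
Variable R : realType.
Variables (s : nat -> seq R) (sigma : nat -> R).
Hypothesis s0 : forall N, {in s N, forall a, 0 <= a}.
Hypothesis scvg : forall k, (fun N => psum (s N) k.+1) @ \oo --> sigma k.+1.
Hypothesis nondeg : forall A, 0 <= A -> ~ (forall j, sigma j.+3 = A * sigma j.+2).

Lemma moment_ge0 k : 0 <= sigma k.+1.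
Proof.
apply: (@ler_cvg_to _ _ _ _ _ _ _ _ (cvg_cst 0) (@scvg k)).
by apply: nearW => N; exact: psum_ge0.
Qed.

Lemma moment_logconvex k : sigma k.+2 ^+ 2 <= sigma k.+1 * sigma k.+3.
Proof.
apply: (@ler_cvg_to _ _ _ _ _ _ _ _ (cvg_exprn (k := 2) (@scvg _)) (cvgM (@scvg _) (@scvg _))).
by apply: nearW => N; exact: psum_logconvex.
Qed.

Lemma cvg_sqdiff A k :
  (fun N => sqdiff (psum (s N)) A k.+1) @ \oo --> sqdiff sigma A k.+1.
Proof.
rewrite /sqdiff; apply: cvgD => //; apply: cvgB.
  by apply: cvgM => //; exact: cvg_cst.
by apply: cvgM => //; exact: cvg_cst.
Qed.

Lemma sqdiff_moment_logconvex A k :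
  sqdiff sigma A k.+2 ^+ 2 <= sqdiff sigma A k.+1 * sqdiff sigma A k.+3.
Proof.
apply: (@ler_cvg_to _ _ _ _ _ _ _ _ (cvg_exprn (k := 2) (@cvg_sqdiff A _))
   (cvgM (@cvg_sqdiff A _) (@cvg_sqdiff A _))).
by apply: nearW => N; exact: sqdiff_logconvex.
Qed.

Lemma momentS_expr_le j k : sigma j.+2 ^+ k.+1 <= sigma k.+1 * sigma j.+1 ^+ k.+1.
Proof.
apply: (@ler_cvg_to _ _ _ _ _ _ _ _ (cvg_exprn (k := k.+1) (@scvg _))
   (cvgM (@scvg _) (cvg_exprn (k := k.+1) (@scvg _)))).
by apply: nearW => N; exact: psumS_expr_le.
Qed.

(** If sigma_2 = 0, then sigma_(j+1) <= sigma_1 sigma_j annihilates all later terms,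
which nondeg excludes for A = 0; log-convexity then propagates positivity. *)
Lemma moment_gt0 k : 0 < sigma k.+1.
Proof.
have step j : sigma j.+2 <= sigma 1%N * sigma j.+1 by have := momentS_expr_le j 0; rewrite !expr1.
have g2 : 0 < sigma 2%N.
  rewrite lt_neqAle moment_ge0 andbT eq_sym; apply/negP => /eqP sg2.
  apply: (nondeg (lexx 0)) => j; rewrite mul0r.
  have Z i : sigma i.+2 = 0.
    elim: i => // i IH; apply/eqP; rewrite eq_le moment_ge0 andbT.
    by apply: le_trans (step _) _; rewrite IH mulr0.
  exact: Z.
elim: k => [|[|k] IH] //.
  rewrite lt_neqAle moment_ge0 andbT eq_sym; apply/negP => /eqP sg1.
  by have := lt_le_trans g2 (step 0%N); rewrite sg1 mul0r ltxx.
have := lt_le_trans (exprn_gt0 2 IH) (moment_logconvex k).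
rewrite pmulr_rgt0 //.
have := moment_ge0 k; rewrite le_eqVlt => /orP[/eqP z|//].
by have := moment_logconvex k; rewrite -z mul0r leNgt exprn_gt0.
Qed.

Definition moment_ratio j : R := sigma j.+2 / sigma j.+1.

Definition moment_ratio_sup : R := sup (range moment_ratio).

Lemma moment_ratio_ndecr : {homo moment_ratio : n m / (n <= m)%N >-> n <= m}.
Proof.
apply/nondecreasing_seqP => n; rewrite /moment_ratio.
rewrite ler_pdivrMr ?moment_gt0 // mulrAC ler_pdivlMr ?moment_gt0 //.
by rewrite -expr2 mulrC moment_logconvex.
Qed.

Lemma moment_ratio_cvg : moment_ratio @ \oo --> moment_ratio_sup.
Proof.
apply: nondecreasing_cvgn; first exact: moment_ratio_ndecr.
exists (sigma 1%N) => _ [j _ <-]; rewrite /moment_ratio ler_pdivrMr ?moment_gt0 //.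
by have := momentS_expr_le j 0; rewrite !expr1.
Qed.

Lemma moment_ratio_le j : moment_ratio j <= moment_ratio_sup.
Proof.
apply: (@ler_cvg_to _ _ _ _ _ _ _ _ (cvg_cst (moment_ratio j)) moment_ratio_cvg).
by exists j => // n /= jn; exact: moment_ratio_ndecr.
Qed.

Lemma moment_ratio_sup_gt0 : 0 < moment_ratio_sup.
Proof. by apply: lt_le_trans (moment_ratio_le 0); rewrite divr_gt0 ?moment_gt0. Qed.

Lemma momentS_le k : sigma k.+2 <= moment_ratio_sup * sigma k.+1.
Proof. by rewrite -ler_pdivrMr ?moment_gt0 // moment_ratio_le. Qed.

Lemma moment_le k : sigma k.+1 <= sigma 1%N * moment_ratio_sup ^+ k.
Proof.
elim: k => [|k IH]; first by rewrite mulr1.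
apply: le_trans (momentS_le k) _; rewrite exprS mulrCA.
by rewrite ler_wpM2l // ltW ?moment_ratio_sup_gt0.
Qed.

Lemma moment_ratio_sup_expr_le k : moment_ratio_sup ^+ k.+1 <= sigma k.+1.
Proof.
apply: (@ler_cvg_to _ _ _ _ _ _ _ _ (cvg_exprn (k := k.+1) moment_ratio_cvg) (cvg_cst _)).
apply: nearW => j; rewrite /moment_ratio expr_div_n ler_pdivrMr ?exprn_gt0 ?moment_gt0 //.
exact: momentS_expr_le.
Qed.

(** Equality at k means that the ratios have reached their supremum, so it holds
at all later indices.  It also propagates to k - 1: the second difference
vanishes at k, hence at k - 1 by log-convexity. *)
Lemma momentS_lt k : sigma k.+2 < moment_ratio_sup * sigma k.+1.
Proof.
rewrite lt_neqAle momentS_le andbT; apply/negP => /eqP Ek.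
have A0 := moment_ratio_sup_gt0; set A := moment_ratio_sup in A0 Ek *.
have up j : (k <= j)%N -> sigma j.+2 = A * sigma j.+1.
  move=> kj; apply/eqP; rewrite eq_le momentS_le -ler_pdivlMr ?moment_gt0 //=.
  apply: le_trans (moment_ratio_ndecr kj).
  by rewrite /moment_ratio Ek mulfK ?gt_eqF ?moment_gt0.
have down d j : (k <= j.+1 + d)%N -> sigma j.+3 = A * sigma j.+2.
  elim: d j => [|d IH] j kj; first by apply: up; rewrite addn0 in kj.
  have e1 := IH j.+1 ltac:(lia); have e2 := IH j.+2 ltac:(lia).
  have t3 : sqdiff sigma A j.+3 = 0 by rewrite /sqdiff e2 e1; ring.
  have t2 : sqdiff sigma A j.+2 = 0.
    have := sqdiff_moment_logconvex A j; rewrite t3 mulr0 => h.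
    by apply/eqP; rewrite -sqrf_eq0 eq_le h sqr_ge0.
  move: t2; rewrite /sqdiff e1 => /eqP.
  rewrite (_ : _ + _ = A * (A * sigma j.+2 - sigma j.+3)); last by ring.
  by rewrite mulf_eq0 gt_eqF //= subr_eq0 => /eqP ->.
by apply: (nondeg (ltW A0)) => j; apply: (down k); rewrite addnC leq_addr.
Qed.

(** Strictness comes from index 2k: A^(2k) <= sigma_(2k) < A^k sigma_k. *)
Lemma moment_ratio_sup_expr_lt k : moment_ratio_sup ^+ k.+1 < sigma k.+1.
Proof.
have A0 := moment_ratio_sup_gt0.
have H j : sigma (k.+1 + j.+1)%N < moment_ratio_sup ^+ j.+1 * sigma k.+1.
  elim: j => [|j IH]; first by rewrite addn1 expr1 momentS_lt.
  rewrite addnS; apply: lt_trans (momentS_lt _) _.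
  by rewrite exprS -mulrA ltr_pM2l // -addnS.
have := moment_ratio_sup_expr_le (k.+1 + k)%N; rewrite -addnS => h.
by have := le_lt_trans h (H k); rewrite exprD ltr_pM2l // exprn_gt0.
Qed.

(** Some power sum satisfies sigma_k x^k < 1, because sigma_k <= sigma_1 A^(k-1);
it bounds (max a x)^k. *)
Lemma near_maxs_lt1 x : 0 <= x -> moment_ratio_sup * x < 1 ->
  \forall N \near \oo, maxs (s N) * x < 1.
Proof.
move=> x0 Ax.
have Ax0 : 0 <= moment_ratio_sup * x by rewrite mulr_ge0 // ltW ?moment_ratio_sup_gt0.
have cv : (fun k => sigma 1%N * x * (moment_ratio_sup * x) ^+ k) @ \oo --> (0 : R).
  rewrite -(mulr0 (sigma 1%N * x)); apply: cvgM; first exact: cvg_cst.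
  by apply: cvg_expr; rewrite ger0_norm.
near \oo => k.
have hk : sigma k.+1 * x ^+ k.+1 < 1.
  apply: (@le_lt_trans _ _ (sigma 1%N * x * (moment_ratio_sup * x) ^+ k)).
    rewrite exprMn exprS [leRHS](_ : _ = sigma 1%N * moment_ratio_sup ^+ k * (x * x ^+ k));
      last by ring.
    by rewrite ler_wpM2r ?moment_le // mulr_ge0 ?exprn_ge0.
  by near: k; apply: (cvgr_lt _ cv).
have cvk : (fun N => psum (s N) k.+1 * x ^+ k.+1) @ \oo --> sigma k.+1 * x ^+ k.+1.
  by apply: cvgM => //; exact: cvg_cst.
apply: filterS (cvgr_lt _ cvk _ hk) => N hN.
have : (maxs (s N) * x) ^+ k.+1 < 1.
  apply: le_lt_trans hN; rewrite exprMn ler_wpM2r ?exprn_ge0 //.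
  by apply: maxs_le_psum; exact: s0.
by rewrite expr_lt1 // mulr_ge0 ?maxs_ge0.
Unshelve. all: by end_near. Qed.

Lemma cvg_maxs : (fun N => maxs (s N)) @ \oo --> moment_ratio_sup.
Proof.
have A0 := moment_ratio_sup_gt0.
apply/cvgrPdist_le => e e0.
have up : \forall N \near \oo, maxs (s N) <= moment_ratio_sup + e.
  have Ae : 0 < moment_ratio_sup + e by exact: addr_gt0.
  have := @near_maxs_lt1 (moment_ratio_sup + e)^-1; rewrite invr_ge0 ltW //.
  rewrite ltr_pdivrMr // mul1r ltrDl => /(_ isT e0); apply: filterS => N.
  by rewrite ltr_pdivrMr // mul1r => /ltW.
have [j hj] : exists j, moment_ratio_sup - e < moment_ratio j.
  near \oo => j; exists j; near: j; apply: (cvgr_gt _ moment_ratio_cvg); lra.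
have lo : \forall N \near \oo, moment_ratio_sup - e < psum (s N) j.+2 / psum (s N) j.+1.
  apply: (cvgr_gt _ _ _ hj); apply: cvgM => //.
  by apply: cvgV => //; rewrite gt_eqF ?moment_gt0.
have pos : \forall N \near \oo, 0 < psum (s N) j.+1.
  exact: (cvgr_gt _ (@scvg j) _ (moment_gt0 j)).
near=> N.
have hu : maxs (s N) <= moment_ratio_sup + e by near: N.
have hl : moment_ratio_sup - e <= maxs (s N).
  apply: (@le_trans _ _ (psum (s N) j.+2 / psum (s N) j.+1)).
    by apply: ltW; near: N.
  rewrite ler_pdivrMr; first by apply: psumS_le; exact: s0.
  by near: N.
by rewrite ler_norml; apply/andP; split; lra.
Unshelve. all: by end_near. Qed.
End LimitMoments.

Section ProductBounds.
Variable R : realType.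

Lemma norm_rootprod_le (t : seq R) x : 0 <= x -> {in t, forall a, 0 <= a} ->
  `|\prod_(a <- t) (1 - a * x)| <= expR (psum t 1 * x).
Proof.
move=> x0; elim: t => [|a t IH] t0.
  by rewrite /psum !big_nil mul0r expR0 normr1.
have a0 : 0 <= a by rewrite t0 ?mem_head.
rewrite /psum !big_cons normrM mulrDl expRD; apply: ler_pM => //.
  apply: le_trans (expR_ge1Dx _); rewrite expr1.
  have := mulr_ge0 a0 x0; rewrite ler_norml => h; apply/andP; split; lra.
by apply: IH => b bt; rewrite t0 // in_cons bt orbT.
Qed.

(** 1 - u >= exp (- u / (1 - th)) for 0 <= u <= th. *)
Lemma rootprod_ge (t : seq R) x th : 0 <= x -> th < 1 ->
    {in t, forall a, 0 <= a} -> {in t, forall a, a * x <= th} ->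
  expR (- (psum t 1 * x / (1 - th))) <= \prod_(a <- t) (1 - a * x).
Proof.
move=> x0 th1; elim: t => [|a t IH] t0 tx.
  by rewrite /psum !big_nil mul0r mul0r oppr0 expR0.
have a0 : 0 <= a by rewrite t0 ?mem_head.
have ax : a * x <= th by rewrite tx ?mem_head.
rewrite /psum !big_cons mulrDl mulrDl opprD expRD; apply: ler_pM; rewrite ?expR_ge0 //.
  rewrite expr1 expRN invf_ple ?posrE ?expR_gt0 //; last by lra.
  apply: le_trans (expR_ge1Dx _).
  have ax0 := mulr_ge0 a0 x0.
  rewrite -[leLHS]mul1r ler_pdivrMr; last by lra.
  have h : a * x * (1 - th) <= a * x * (1 - a * x) by rewrite ler_wpM2l //; lra.
  have : a * x <= a * x / (1 - th) * (1 - a * x).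
    by rewrite mulrAC ler_pdivlMr //; lra.
  by lra.
by apply: IH => b bt; [rewrite t0|rewrite tx]; rewrite // in_cons bt orbT.
Qed.
End ProductBounds.

(** * Products with positive parameters and their limits *)

Section FiniteProducts.
Variable R : realType.
Implicit Types (s t : seq R) (x y : R) (z : R[i]).
Notation toC := (real_complex R).
Notation horC p z := (map_poly toC p).[z].

Lemma horC_real (p : {poly R}) x : horC p x%:C = p.[x]%:C.
Proof. exact: horner_map. Qed.

Lemma rootprod_gt0 s x : {in s, forall a, a * x < 1} -> 0 < (rootprod s).[x].
Proof.
move=> sx; rewrite horner_rootprod big_seq prodr_gt0 // => a /sx; lra.
Qed.

Lemma rootprod_sign s x : 0 <= x -> {in s, forall a, 0 <= a} ->
    {in s, forall a, a * x <= 1} ->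
  0 <= (rootprod s).[x] /\ (rootprod s)^`().[x] <= 0.
Proof.
move=> x0; elim: s => [|a s IH] s0 sx.
  by rewrite /rootprod big_nil -[1 : {poly R}]/(1%:P) derivC hornerC horner0.
have a0 : 0 <= a by rewrite s0 ?mem_head.
have ax : a * x <= 1 by rewrite sx ?mem_head.
have [||P0 P1] := IH; try by move=> b bs; rewrite ?s0 ?sx // in_cons bs orbT.
rewrite deriv_rootprod_cons rootprod_cons hornerM.
have -> : (1 - a *: 'X).[x] = 1 - a * x by rewrite !hornerE.
split; first by rewrite mulr_ge0 //; lra.
have := mulr_ge0 a0 P0; have : 0 <= 1 - a * x by lra.
move=> h1 h2; have := mulr_ge0_le0 h1 P1; lra.
Qed.

Lemma cabs_rootprod_ge s z : {in s, forall a, 0 <= a} ->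
    {in s, forall a, a * cabs z < 1} ->
  (rootprod s).[cabs z] <= cabs (horC (rootprod s) z).
Proof.
elim: s => [|a s IH] s0 sx.
  rewrite /rootprod big_nil rmorph1 -[1 : {poly R}]/(1%:P) -[1 : {poly R[i]}]/(1%:P).
  by rewrite !hornerC (cabs_real 1) normr1.
have a0 : 0 <= a by rewrite s0 ?mem_head.
have ax : a * cabs z < 1 by rewrite sx ?mem_head.
have s0' b : b \in s -> 0 <= b by move=> bs; rewrite s0 // in_cons bs orbT.
have sx' b : b \in s -> b * cabs z < 1 by move=> bs; rewrite sx // in_cons bs orbT.
rewrite rootprod_cons rmorphM !hornerM cabsM; apply: ler_pM.
- by rewrite !hornerE; lra.
- by rewrite ltW ?rootprod_gt0.
- rewrite rmorphB rmorph1 /= map_polyZ map_polyX !hornerE.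
  have := cabs_dist_le 1 (a%:C * z); rewrite cabsM cabs_real (cabs_real 1) normr1 (ger0_norm a0).
  by have := ler_norm (1 - a * cabs z); lra.
- exact: IH.
Qed.

(** Dividing by both values of the product, this says that
|sum_b b z / (1 - b z)| is at most its value at |z|. *)
Lemma cabs_logderiv_le s z : {in s, forall a, 0 <= a} ->
    {in s, forall a, a * cabs z < 1} ->
  cabs (z * horC (rootprod s)^`() z) * (rootprod s).[cabs z] <=
  - (cabs z * (rootprod s)^`().[cabs z]) * cabs (horC (rootprod s) z).
Proof.
set x := cabs z; elim: s => [|a s IH] s0 sx.
  rewrite /rootprod big_nil -[1 : {poly R}]/(1%:P) derivC rmorph0 !horner0 !mulr0.
  by rewrite oppr0 cabs0 !mul0r.
have x0 : 0 <= x by exact: cabs_ge0.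
have a0 : 0 <= a by rewrite s0 ?mem_head.
have ax : a * x < 1 by rewrite sx ?mem_head.
have s0' b : b \in s -> 0 <= b by move=> bs; rewrite s0 // in_cons bs orbT.
have sx' b : b \in s -> b * x < 1 by move=> bs; rewrite sx // in_cons bs orbT.
have {}IH := IH s0' sx'.
have P0 : 0 < (rootprod s).[x] := rootprod_gt0 sx'.
have -> : horC (rootprod (a :: s))^`() z = (1 - a%:C * z) * horC (rootprod s)^`() z
    - a%:C * horC (rootprod s) z.
  by rewrite -!deriv_map !map_rootprod map_cons deriv_rootprod_cons.
rewrite deriv_rootprod_cons rootprod_cons rmorphM /= !hornerM.
have -> : (1 - a *: 'X).[x] = 1 - a * x by rewrite !hornerE.
have -> : (map_poly toC (1 - a *: 'X)).[z] = 1 - a%:C * z.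
  by rewrite rmorphB rmorph1 /= map_polyZ map_polyX !hornerE.
set P := (rootprod s).[x] in IH P0 *; set P' := (rootprod s)^`().[x] in IH *.
set Q' := horC _ z in IH *; set Q := horC _ z in IH *.
have q1 : 1 - a * x <= cabs (1 - a%:C * z).
  have := cabs_dist_le 1 (a%:C * z); rewrite cabsM cabs_real (cabs_real 1) normr1 (ger0_norm a0).
  by have := ler_norm (1 - a * x); rewrite -/x; lra.
have tri : cabs (z * ((1 - a%:C * z) * Q' - a%:C * Q)) <=
   cabs (1 - a%:C * z) * cabs (z * Q') + a * x * cabs Q.
  have -> : z * ((1 - a%:C * z) * Q' - a%:C * Q) = (1 - a%:C * z) * (z * Q') - a%:C * z * Q.
    by rewrite mulrBr; congr (_ - _); [rewrite mulrCA|rewrite mulrCA mulrA].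
  apply: le_trans (cabsB _ _) _.
  by rewrite !cabsM cabs_real (ger0_norm a0) -/x lerD2l.
rewrite [cabs (_ * Q)]cabsM.
set q := cabs (1 - _ * z) in q1 tri *.
set CQ := cabs Q in IH tri *; set CQ' := cabs (z * Q') in IH tri *.
have CQ0 : 0 <= CQ by exact: cabs_ge0.
have omx : 0 <= 1 - a * x by lra.
have q0 : 0 <= q by lra.
have pP0 : 0 <= (1 - a * x) * P by rewrite mulr_ge0 // ltW.
apply: le_trans (ler_wpM2r pP0 tri) _.
have h1 : (q * CQ') * ((1 - a * x) * P) <= (1 - a * x) * q * (- (x * P') * CQ).
  rewrite [leLHS](_ : _ = (1 - a * x) * q * (CQ' * P)); last by ring.
  by rewrite ler_wpM2l // mulr_ge0.
have h2 : a * x * CQ * ((1 - a * x) * P) <= a * x * CQ * (q * P).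
  by rewrite ler_wpM2l ?mulr_ge0 // ler_wpM2r // ltW.
by move: h1 h2; lra.
Qed.

(** At the smallest root y of the second product its derivative is not positive, so
the first product would be <= 0 at y if y were at most x. *)
Lemma posroot_pullback s t x : 0 <= x -> {in t, forall b, 0 <= b} ->
    rootprod s = rootprod t + 2 *: ('X * (rootprod t)^`()) ->
    {in s, forall a, 0 <= a} -> {in s, forall a, a * x < 1} ->
  {in t, forall b, b * x < 1}.
Proof.
move=> x0 t0 E s0 sx b bt.
apply: le_lt_trans (ler_wpM2r x0 (le_maxs bt)) _.
rewrite ltNge; apply/negP => Bx.
have B0 : 0 < maxs t.
  by rewrite lt_def maxs_ge0 andbT; apply: contraTneq Bx => ->; rewrite mul0r -ltNge.
(* The smallest root of the second product. *)
pose y := (maxs t)^-1.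
have y0 : 0 <= y by rewrite invr_ge0 ltW.
have yx : y <= x by rewrite -[y]mul1r ler_pdivrMr // mulrC.
have Dy : 0 < (rootprod s).[y].
  apply: rootprod_gt0 => a sa; apply: le_lt_trans (sx a sa).
  by rewrite ler_wpM2l ?s0.
have [|_ h] := @rootprod_sign t y y0 t0.
  by move=> c ct; rewrite ler_pdivrMr // mul1r le_maxs.
have Hy : (rootprod t).[y] = 0.
  rewrite horner_rootprod; apply/eqP; rewrite prodf_seq_eq0; apply/hasP.
  by exists (maxs t); [exact: maxs_mem|rewrite /= /y mulfV ?lt0r_neq0 // subrr].
move: Dy; rewrite E hornerD hornerZ hornerM hornerX Hy add0r.
by have := mulr_ge0_le0 y0 h; lra.
Qed.
End FiniteProducts.

Section EntireLimits.
Variable R : realType.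
Notation toC := (real_complex R).
Notation horC p z := (map_poly toC p).[z].

Lemma cvg_cabs (u : nat -> R[i]) l : ccvg u l -> (fun n => cabs (u n)) @ \oo --> cabs l.
Proof.
move=> ul; apply/cvgrPdist_le => e e0; apply: filterS (ccvg_near ul e0) => n.
exact: le_trans (cabs_dist_le _ _).
Qed.

Lemma ccvg_real (u : nat -> R) l : ccvg (fun n => (u n)%:C) l ->
  l = (complex.Re l)%:C /\ u @ \oo --> complex.Re l.
Proof.
move=> ul; split.
  apply/eqP; rewrite eq_complex /= eqxx /= -normr_le0; apply/ler_addgt0Pr => e e0.
  near \oo => n.
  have h : cabs (l - (u n)%:C) <= e by near: n; exact: ccvg_near.
  have := le_trans (Im_le_cabs _) h; rewrite raddfB /= subr0 add0r; exact.
apply/cvgrPdist_le => e e0; apply: filterS (ccvg_near ul e0) => n h.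
by have := le_trans (Re_le_cabs _) h; rewrite raddfB.
Unshelve. all: by end_near. Qed.

Variables (c : nat -> R) (p : nat -> {poly R}).
Hypothesis ec : entire c.
Hypothesis pc : forall N n, `|(p N)`_n| <= `|c n|.
Hypothesis pcvg : forall n, (fun N => (p N)`_n) @ \oo --> c n.

Lemma ccvg_poly z : ccvg (fun N => horC (p N) z) (pser c z).
Proof.
have := @tannery _ c (fun N n => (p N)`_n) z ec pc pcvg.
rewrite /ccvg; under eq_fun do rewrite pser_poly; exact.
Qed.

Lemma ccvg_deriv_poly z : ccvg (fun N => horC (p N)^`() z) (pser (shiftderiv c) z).
Proof.
have : ccvg (fun N => pser (fun n => (p N)^`()`_n) z) (pser (shiftderiv c) z).
  apply: tannery; first exact: entire_shiftderiv.
  - move=> N n; rewrite coef_deriv /shiftderiv -[_ *+ n.+1]mulr_natl !normrM.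
    by rewrite ler_wpM2l.
  - move=> n; under eq_fun do rewrite coef_deriv -[_ *+ n.+1]mulr_natl.
    by apply: cvgM; [exact: cvg_cst|exact: pcvg].
by rewrite /ccvg; under eq_fun do rewrite pser_poly.
Qed.

Lemma pser_real x : pser c x%:C = (complex.Re (pser c x%:C))%:C.
Proof.
have := ccvg_poly x%:C; rewrite /ccvg; under eq_fun do rewrite horC_real.
by case/ccvg_real.
Qed.

Lemma cvg_poly_real x : (fun N => (p N).[x]) @ \oo --> complex.Re (pser c x%:C).
Proof.
have := ccvg_poly x%:C; rewrite /ccvg; under eq_fun do rewrite horC_real.
by case/ccvg_real.
Qed.

Lemma cvg_deriv_poly_real x :
  (fun N => (p N)^`().[x]) @ \oo --> complex.Re (pser (shiftderiv c) x%:C).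
Proof.
have := ccvg_deriv_poly x%:C; rewrite /ccvg; under eq_fun do rewrite horC_real.
by case/ccvg_real.
Qed.
End EntireLimits.

Section SmallestRoot.
Variable R : realType.
Variables (c sigma : nat -> R) (s : nat -> seq R).
Hypothesis ec : entire c.
Hypothesis s0 : forall N, {in s N, forall a, 0 <= a}.
Hypothesis pc : forall N n, `|(rootprod (s N))`_n| <= `|c n|.
Hypothesis pcvg : forall n, (fun N => (rootprod (s N))`_n) @ \oo --> c n.
Hypothesis hsg : forall n, n.+1%:R * c n.+1 = - \sum_(m < n.+1) sigma m.+1 * c (n - m)%N.
Hypothesis nondeg : forall A, 0 <= A -> ~ (forall j, sigma j.+3 = A * sigma j.+2).

Let scvg := cvg_psum pcvg hsg.
Let A := moment_ratio_sup sigma.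
Let A0 : 0 < A := moment_ratio_sup_gt0 s0 scvg nondeg.

(** The factor 1 - max a / A of the approximating product tends to 0, and the
product of the other factors is bounded by the exponential of sigma_1 / A. *)
Lemma pser_root : pser c (A^-1)%:C = 0.
Proof.
rewrite (pser_real ec pc pcvg).
suff -> : complex.Re (pser c (A^-1)%:C) = 0 by [].
have cv := @cvg_poly_real _ _ _ ec pc pcvg A^-1.
suff cv0 : (fun N => (rootprod (s N)).[A^-1]) @ \oo --> (0 : R).
  have hd : hausdorff_space R by exact: norm_hausdorff.
  by rewrite -(cvg_lim hd cv) (cvg_lim hd cv0).
have A10 : 0 <= A^-1 by rewrite invr_ge0 ltW.
have cm : (fun N => maxs (s N)) @ \oo --> A := cvg_maxs s0 scvg nondeg.
have cb : (fun N => `|1 - maxs (s N) / A| * expR ((sigma 1%N + 1) / A)) @ \oo --> (0 : R).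
  rewrite -(mul0r (expR ((sigma 1%N + 1) / A))); apply: cvgM; last exact: cvg_cst.
  have := cvg_norm (cvgB (cvg_cst (1 : R)) (cvgM cm (cvg_cst (A^-1 : R)))).
  by rewrite divff ?lt0r_neq0 // subrr normr0; apply.
have cbN : (fun N => - (`|1 - maxs (s N) / A| * expR ((sigma 1%N + 1) / A))) @ \oo --> (0 : R).
  by rewrite -oppr0; exact: cvgN.
apply: squeeze_cvgr cbN cb.
have m0 : \forall N \near \oo, 0 < maxs (s N) by exact: (cvgr_gt _ cm).
have m1 : \forall N \near \oo, psum (s N) 1 <= sigma 1%N + 1.
  by apply: (cvgr_le (sigma 1%N)); [exact: scvg|lra].
near=> N; rewrite -ler_norml horner_rootprod.
have mN : maxs (s N) \in s N by apply: maxs_mem; near: N.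
rewrite (big_rem _ mN) normrM /= ler_wpM2l //.
apply: le_trans (@norm_rootprod_le _ _ A^-1 A10 _) _.
  by move=> a /mem_rem; exact: s0.
rewrite ler_expR ler_wpM2r //.
apply: (@le_trans _ _ (psum (s N) 1)); last by near: N.
by rewrite /psum (big_rem _ mN) /= lerDr expr1 maxs_ge0.
Unshelve. all: by end_near. Qed.

(** Eventually all a x are at most some th < 1, so that the approximating products
stay above a fixed exponential. *)
Lemma pser_gt0 x : 0 <= x -> A * x < 1 -> 0 < complex.Re (pser c x%:C).
Proof.
move=> x0 Ax.
have Ax0 : 0 <= A * x by rewrite mulr_ge0 // ltW.
(* Any number strictly between A x and 1. *)
pose th := (A * x + 1) / 2.
have th0 : 0 < th by rewrite /th; lra.
have th1 : th < 1 by rewrite /th; lra.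
have hm := @near_maxs_lt1 _ s sigma s0 scvg nondeg (x / th).
have m1 : \forall N \near \oo, psum (s N) 1 <= sigma 1%N + 1.
  by apply: (cvgr_le (sigma 1%N)); [exact: scvg|lra].
apply: (@lt_le_trans _ _ (expR (- ((sigma 1%N + 1) * x / (1 - th))))); first exact: expR_gt0.
apply: (@ler_cvg_to _ _ _ _ _ _ _ _ (cvg_cst _) (@cvg_poly_real _ _ _ ec pc pcvg x)).
near=> N; rewrite horner_rootprod.
have hN : maxs (s N) * (x / th) < 1.
  near: N; apply: hm; first by rewrite divr_ge0 // ltW.
  by rewrite -/A mulrA ltr_pdivrMr // mul1r /th; lra.
apply: le_trans (@rootprod_ge _ (s N) x th x0 th1 (@s0 N) _); last first.
  move=> a sa; move: hN; rewrite mulrA ltr_pdivrMr // mul1r => /ltW; apply: le_trans.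
  by rewrite ler_wpM2r // le_maxs.
rewrite ler_expR lerN2 ler_wpM2r ?invr_ge0 ?subr_ge0 ?(ltW th1) // ler_wpM2r //.
by near: N.
Unshelve. all: by end_near. Qed.
End SmallestRoot.

(** * Laguerre approximations *)

Lemma coef_comp_polyZX (F : comNzRingType) (p : {poly F}) k n :
  (p \Po (k *: 'X))`_n = k ^+ n * p`_n.
Proof.
rewrite comp_polyE.
rewrite (eq_bigr (fun i : 'I_(size p) => (p`_i * k ^+ i) *: 'X^i)); last first.
  by move=> i _; rewrite exprZn scalerA.
rewrite -(poly_def _ (fun i => p`_i * k ^+ i)) coef_poly mulrC.
by case: ltnP => // h; rewrite nth_default ?mulr0.
Qed.

Section Laguerre.
Variables (R : realType) (nu : R).
Hypothesis hnu : -1 < nu.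

Let nu1 : 0 < nu + 1. Proof. by move: hnu; lra. Qed.

(** A multiple of the classical Laguerre polynomial of parameter nu. *)
Definition laguerre N : {poly R} :=
  \poly_(n < N.+1) ((-1) ^+ n * 'C(N, n)%:R / pochhammer (nu + 1) n).

Lemma coef_laguerre N n :
  (laguerre N)`_n = (-1) ^+ n * 'C(N, n)%:R / pochhammer (nu + 1) n.
Proof.
rewrite coef_poly ltnS; case: leqP => // Nn.
by rewrite bin_small // mulr0 mul0r.
Qed.

(** For the classical Laguerre polynomials the recursion is
(N+1) L_(N+1) = (N+1+nu - X) L_N + X L_N'; dividing them by their values at 0
changes the factor N + 1 on the left into nu + 1 + N. *)
Lemma laguerreS N :
  laguerre N.+1 = laguerre N * (1 - (nu + 1 + N%:R)^-1 *: 'X)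
                  + (nu + 1 + N%:R)^-1 *: ('X * (laguerre N)^`()).
Proof.
have kN : nu + 1 + N%:R != 0 by rewrite gt_eqF // ltr_wpDr.
apply/polyP => n; rewrite coefD mulrBr mulr1 coefB coefZ coefXM -scalerAr coefZ coefMX coef_deriv.
rewrite !coef_laguerre; case: n => [|n] /=.
  by rewrite !bin0 mulr0 subr0 addr0.
rewrite binS natrD.
have pn := pochhammer_nu_neq0 hnu n.
have kn : nu + 1 + n%:R != 0 by rewrite gt_eqF // ltr_wpDr.
have key : n.+1%:R * 'C(N, n.+1)%:R = N%:R * 'C(N, n)%:R - n%:R * 'C(N, n)%:R :> R.
  have [nN|Nn] := leqP n N.
    by rewrite -natrM mul_bin_left natrM natrB // mulrBl.
  by rewrite !bin_small ?(ltnW Nn) // ?ltnS ?(ltnW Nn) // !mulr0 subrr.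
rewrite pochhammerS exprS -[_ *+ n.+1]mulr_natl.
set C1 := 'C(N, n.+1)%:R in key *; set C0 := 'C(N, n)%:R in key *.
set P := pochhammer _ n in pn *; set e := (-1) ^+ n.
have -> : n.+1%:R * (-1 * e * C1 / (P * (nu + 1 + n%:R))) =
   - e * (N%:R * C0 - n%:R * C0) / (P * (nu + 1 + n%:R)).
  by rewrite -key; field; rewrite pn kn.
by field; rewrite pn kn kN.
Qed.

Lemma posrooted_laguerre N : posrooted (laguerre N).
Proof.
elim: N => [|N IH].
  suff -> : laguerre 0 = 1 by exact: posrooted1.
  apply/polyP => n; rewrite coef_laguerre coef1; case: n => [|n].
    by rewrite /pochhammer big_ord0 expr0 bin0 mulr1 divr1.
  by rewrite bin0n mulr0 mul0r.
have k0 : 0 < (nu + 1 + N%:R)^-1 by rewrite invr_gt0 ltr_wpDr.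
by rewrite laguerreS; apply: posrooted_step => //; exact: ltW.
Qed.

Definition bessel_coef n : R := (-1) ^+ n / (4 ^+ n * n`!%:R * pochhammer (nu + 1) n).
Definition dh_coef n : R := n.+1%:R * bessel_coef n.

(** The ratio between the coefficients of the approximating polynomials and those
of their limits. *)
Definition ffweight N n : R := (N.+1 ^_ n)%:R / N.+1%:R ^+ n.

Lemma ffweight_itv N n : 0 <= ffweight N n <= 1.
Proof.
rewrite /ffweight divr_ge0 ?exprn_ge0 //= ler_pdivrMr ?exprn_gt0 // mul1r -natrX ler_nat.
elim: n => [|n IH]; first by rewrite ffactn0 expn0.
by rewrite ffactnSr expnSr leq_mul // leq_subr.
Qed.

Lemma ffweight_cvg n : (fun N => ffweight N n) @ \oo --> (1 : R).
Proof.
elim: n => [|n IH].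
  rewrite /ffweight; under eq_fun do rewrite ffactn0 expr0 divr1.
  exact: cvg_cst.
have h : (fun N : nat => 1 - n%:R * (N.+1%:R)^-1 : R) @ \oo --> (1 : R).
  have := cvgB (cvg_cst (1 : R)) (cvgM (cvg_cst (n%:R : R)) (@cvg_harmonic R)).
  by rewrite mulr0 subr0; apply.
have H := cvgM IH h; rewrite mulr1 in H; apply: cvg_trans (H _); apply: near_eq_cvg.
exists n => // N /= nN; rewrite /ffweight ffactnSr natrM natrB ?(leq_trans nN) // exprSr.
rewrite /GRing.mul_fun /=; field.
by rewrite expf_neq0 ?andbT -?natrD -?[1 + N%:R]natr1 -?(natrD R 1) pnatr_eq0.
Qed.

Definition scaled_laguerre N := laguerre N.+1 \Po ((4 * N.+1%:R)^-1 *: 'X).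
(** The derivative of X times the rescaled Laguerre polynomial, hence an
approximation of h'. *)
Definition dh_poly N := scaled_laguerre N + 'X * (scaled_laguerre N)^`().
Definition delta_poly N := dh_poly N + 2 *: ('X * (dh_poly N)^`()).

Lemma coef_scaled_laguerre N n : (scaled_laguerre N)`_n = ffweight N n * bessel_coef n.
Proof.
rewrite /scaled_laguerre coef_comp_polyZX coef_laguerre /ffweight /bessel_coef -bin_ffact natrM.
have pn := pochhammer_nu_neq0 hnu n.
have fn : n`!%:R != 0 :> R by rewrite pnatr_eq0 -lt0n fact_gt0.
have Nn : N.+1%:R ^+ n != 0 :> R by rewrite expf_neq0.
have f4 : 4 ^+ n != 0 :> R by rewrite expf_neq0.
by rewrite exprVn exprMn; field; rewrite pn fn Nn f4.
Qed.

Lemma coef_addXderiv (F : comNzRingType) (p : {poly F}) (k : F) n :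
  (p + k *: ('X * p^`()))`_n = (1 + k * n%:R) * p`_n.
Proof.
rewrite coefD coefZ coefXM coef_deriv; case: n => [|n] /=; first by ring.
by rewrite -[_ *+ n.+1]mulr_natl; ring.
Qed.

Lemma coef_dh_poly N n : (dh_poly N)`_n = ffweight N n * dh_coef n.
Proof.
rewrite /dh_poly -['X * _]scale1r coef_addXderiv coef_scaled_laguerre /dh_coef.
by rewrite -natr1; ring.
Qed.

Lemma mu_coefE n : mu_coef nu n = (2 * n + 1)%:R * dh_coef n.
Proof.
rewrite /mu_coef /dh_coef /bessel_coef exprM -natrX /= natrM mulrA; ring.
Qed.

Lemma coef_delta_poly N n : (delta_poly N)`_n = ffweight N n * mu_coef nu n.
Proof.
by rewrite /delta_poly coef_addXderiv coef_dh_poly mu_coefE natrD natrM; ring.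
Qed.

Lemma posrooted_dh_poly N : posrooted (dh_poly N).
Proof.
have -> : dh_poly N = scaled_laguerre N * (1 - 0 *: 'X) + 1 *: ('X * (scaled_laguerre N)^`()).
  by rewrite scale0r subr0 mulr1 scale1r.
apply: posrooted_step => //; apply: posrooted_scale; last exact: posrooted_laguerre.
by rewrite invr_gt0 mulr_gt0.
Qed.

Lemma posrooted_delta_poly N : posrooted (delta_poly N).
Proof.
have -> : delta_poly N = dh_poly N * (1 - 0 *: 'X) + 2 *: ('X * (dh_poly N)^`()).
  by rewrite scale0r subr0 mulr1.
by apply: posrooted_step => //; exact: posrooted_dh_poly.
Qed.

Lemma entire_bessel_coef : entire bessel_coef.
Proof.
move=> rho rho0; pose x := rho / (4 * (nu + 1)).
have x0 : 0 <= x by rewrite divr_ge0 // mulr_ge0 // ltW.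
exists (expR x) => n.
have pge : (nu + 1) ^+ n <= pochhammer (nu + 1) n.
  elim: n => [|n IH]; first by rewrite /pochhammer big_ord0.
  rewrite pochhammerS exprSr; apply: ler_pM => //; rewrite ?exprn_ge0 ?(ltW nu1) //.
  by rewrite lerDl.
have -> : `|bessel_coef n| = (4 ^+ n * n`!%:R * pochhammer (nu + 1) n)^-1.
  rewrite /bessel_coef normrM normrX normrN1 expr1n mul1r ger0_norm // invr_ge0.
  by rewrite !mulr_ge0 ?exprn_ge0 // ltW // pochhammer_gt0.
apply: (@le_trans _ _ (x ^+ n / n`!%:R)).
  rewrite /x expr_div_n exprMn mulrC -[leRHS]mulrA ler_wpM2l ?exprn_ge0 //.
  rewrite -invfM lef_pV2 ?posrE ?mulr_gt0 ?exprn_gt0 ?pochhammer_gt0 ?ltr0n ?fact_gt0 //.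
  by rewrite mulrAC ler_wpM2l ?mulr_ge0 ?exprn_ge0.
case: n {pge} => [|n]; first by rewrite expr0 fact0 divr1 -expR0 ler_expR.
by have := expR_ge1Dxn n x0; lra.
Qed.

Lemma entire_mulnat (c : nat -> R) k : entire c -> entire (fun n => (k * n + 1)%:R * c n).
Proof.
move=> ec rho rho0; have [|M HM] := ec (rho + 2); first by lra.
exists ((k%:R * rho + 1) * M) => n; rewrite normrM ger0_norm //.
have kr : 0 <= k%:R * rho :> R by rewrite mulr_ge0.
apply: (@le_trans _ _ ((k%:R * rho + 1) * (`|c n| * (rho + 2) ^+ n))); last first.
  by rewrite ler_wpM2l //; lra.
have h1 : rho ^+ n <= (rho + 2) ^+ n by apply: lerXn2r; rewrite ?nnegrE; lra.
have h2 : n%:R * rho ^+ n <= rho * (rho + 2) ^+ n.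
  have := ler_wpM2l rho0 (mulrn_expr_le n rho0).
  case: n {HM h1} => [|n] /=; first by rewrite !mul0r mulr0; lra.
  by rewrite mulrCA -exprS.
have h3 := ler_wpM2l (normr_ge0 (c n)) h1.
have := ler_wpM2l (normr_ge0 (c n)) (ler_wpM2l (ler0n R k) h2).
by rewrite natrD natrM; lra.
Qed.

Lemma entire_dh_coef : entire dh_coef.
Proof.
apply: entire_le (@entire_mulnat bessel_coef 1 entire_bessel_coef) => n.
by rewrite /dh_coef mul1n addn1.
Qed.

Lemma entire_mu : entire (mu_coef nu).
Proof.
by apply: entire_le (@entire_mulnat dh_coef 2 entire_dh_coef) => n; rewrite mu_coefE.
Qed.

Definition h_coef n : R := if n is n'.+1 then bessel_coef n' else 0.

Lemma entire_h_coef : entire h_coef.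
Proof.
move=> rho rho0; have [M HM] := entire_bessel_coef rho0; exists (rho * M) => -[|n].
  have := HM 0%N; rewrite /= normr0 mul0r expr0 => h.
  by rewrite mulr_ge0 //; have := normr_ge0 (bessel_coef 0); lra.
by rewrite /= exprS mulrCA ler_wpM2l.
Qed.

Lemma bessel_hE : bessel_h nu = pser h_coef.
Proof.
apply/funext => z; rewrite /bessel_h; apply: csum_unique.
have H := pser_ccvg z entire_h_coef.
apply: ccvgP => e e0; have [K _ HK] := ccvg_near H e0.
exists K => // n /= Kn; have := HK n.+1 (leqW Kn).
by rewrite /ptrunc big_nat_recl //= mul0r add0r.
Qed.

Lemma cderiv_bessel_h : cderiv (bessel_h nu) = pser dh_coef.
Proof.
apply/funext => z; rewrite bessel_hE pser_deriv //; exact: entire_h_coef.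
Qed.

Lemma cderiv2_bessel_h : cderiv (cderiv (bessel_h nu)) = pser (shiftderiv dh_coef).
Proof.
apply/funext => z; rewrite cderiv_bessel_h pser_deriv //; exact: entire_dh_coef.
Qed.

End Laguerre.

(** * The sigma_n are not eventually geometric *)

Section NonDegeneracy.
Variables (R : realType) (nu : R).
Hypothesis hnu : -1 < nu.

Lemma archi_le0 (x C : R) : (forall n : nat, x * n.+1%:R <= C) -> x <= 0.
Proof.
move=> H; rewrite leNgt; apply/negP => x0.
have C0 : 0 <= C by apply: le_trans (H 0%N); rewrite mulr1 ltW.
have := H (Num.truncn (C / x)); apply/negP; rewrite -ltNge mulrC -ltr_pdivrMr //.
exact: truncnS_gt.
Qed.

Let m n : R := (-1) ^+ n * mu_coef nu n.

Lemma mu_abs_decay n : n%:R ^+ 2 * m n.+1 <= m n.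
Proof.
have P0 := pochhammer_gt0 n (x := nu + 1) ltac:(move: hnu; lra).
have mE k : m k = (k.+1 * (2 * k + 1))%:R / (2 ^+ (2 * k) * k`!%:R * pochhammer (nu + 1) k).
  by rewrite /m /mu_coef !mulrA -exprMn mulrNN mulr1 expr1n mul1r.
have F0 : 0 < n`!%:R :> R by rewrite ltr0n fact_gt0.
have E0 : 0 < 2 ^+ (2 * n) :> R by rewrite exprn_gt0.
have n0 : 0 <= n%:R :> R by [].
have nn1 : 0 < nu + 1 + n%:R by move: hnu; lra.
have E1 : (2 * n.+1 = 2 + 2 * n)%N by lia.
rewrite !mE pochhammerS factS E1 exprD.
set D := 2 ^+ (2 * n) * n`!%:R * pochhammer (nu + 1) n.
have D0 : 0 < D by rewrite !mulr_gt0.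
have -> : 2 ^+ 2 * 2 ^+ (2 * n) * (n.+1 * n`!)%:R * (pochhammer (nu + 1) n * (nu + 1 + n%:R))
  = D * (4 * (n%:R + 1) * (nu + 1 + n%:R)).
  by rewrite natrM -natr1 /D; ring.
have K0 : 0 < 4 * (n%:R + 1) * (nu + 1 + n%:R) :> R.
  by rewrite !mulr_gt0 // ltr_wpDl.
rewrite [leLHS]mulrA ler_pdivrMr; last by rewrite mulr_gt0.
rewrite [leRHS]mulrA divfK ?lt0r_neq0 //.
have -> : (n.+2 * (2 + 2 * n + 1))%:R = (n%:R + 2) * (2 * n%:R + 3) :> R.
  by rewrite natrM (natrD R (2 + 2 * n)) (natrD R 2) (natrM R 2) -(addn2 n) (natrD R n); ring.
have -> : (n.+1 * (2 * n + 1))%:R = (n%:R + 1) * (2 * n%:R + 1) :> R.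
  by rewrite natrM (natrD R (2 * n)) (natrM R 2) -natr1; ring.
set y : R := n%:R in n0 nn1 K0 *.
have h : (y + 1) * (2 * y + 1) * (4 * (y + 1) * y) <=
    (y + 1) * (2 * y + 1) * (4 * (y + 1) * (nu + 1 + y)).
  rewrite ler_wpM2l ?mulr_ge0 //; try by lra.
  by rewrite ler_wpM2l ?mulr_ge0 //; move: hnu; lra.
apply: le_trans h; nra.
Qed.

(** Subtracting A times the recursion at n from the recursion at n + 1 leaves a
relation between three consecutive coefficients, which with m_n = |mu_n| reads
C m_n = (n+2) m_(n+2) + (A (n+1) - sigma_1) m_(n+1).  As m_n >= n^2 m_(n+1), letting
n grow shows in turn that C = 0, A = 0 and sigma_1 <= 0, but then the right-hand
side is positive. *)
Lemma mu_nondegenerate (sigma : nat -> R) :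
    (forall n, n.+1%:R * mu_coef nu n.+1 = - \sum_(k < n.+1) sigma k.+1 * mu_coef nu (n - k)) ->
  forall A, 0 <= A -> ~ (forall j, sigma j.+3 = A * sigma j.+2).
Proof.
move=> hsg A A0 HA.
have m0 n : 0 < m n := mu_coef_sign hnu n.
pose C := A * sigma 1%N - sigma 2%N.
have rec n : C * m n = n.+2%:R * m n.+2 + (A * n.+1%:R - sigma 1%N) * m n.+1.
  have e1 : n.+2%:R * mu_coef nu n.+2 - A * (n.+1%:R * mu_coef nu n.+1) =
      - (sigma 1%N * mu_coef nu n.+1) + C * mu_coef nu n.
    have s1 : \sum_(k < n.+2) sigma k.+1 * mu_coef nu (n.+1 - k) =
        sigma 1%N * mu_coef nu n.+1 + sigma 2%N * mu_coef nu n
        + \sum_(k < n) sigma k.+3 * mu_coef nu (n.+1 - k.+2).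
      by rewrite !big_ord_recl /= !subn0 subSS subn0 addrA.
    have s2 : \sum_(k < n.+1) sigma k.+1 * mu_coef nu (n - k) =
        sigma 1%N * mu_coef nu n + \sum_(k < n) sigma k.+2 * mu_coef nu (n - k.+1).
      by rewrite big_ord_recl /= subn0.
    rewrite !hsg s1 s2 (eq_bigr (fun i : 'I_n => A * (sigma i.+2 * mu_coef nu (n - i.+1)))).
      by rewrite -mulr_sumr /C; ring.
    by move=> i _; rewrite HA subSS -mulrA.
  have := congr1 (fun t => (-1) ^+ n * t) e1; rewrite /= /m !exprS => h.
  have -> : C * ((-1) ^+ n * mu_coef nu n) =
     (-1) ^+ n * (- (sigma 1%N * mu_coef nu n.+1) + C * mu_coef nu n)
      + (-1) ^+ n * sigma 1%N * mu_coef nu n.+1 by ring.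
  by rewrite -h; ring.
have dec n : n.+1%:R ^+ 2 * m n.+2 <= m n.+1 by exact: mu_abs_decay.
clearbody m.
have dec2 n : n.+2%:R * m n.+2 <= 2 * m n.+1.
  apply: (@le_trans _ _ (2 * (n.+1%:R ^+ 2 * m n.+2))); last by rewrite ler_wpM2l.
  rewrite mulrA ler_wpM2r ?(ltW (m0 _)) // -natr1 -[n.+1%:R]natr1.
  by have : 0 <= n%:R :> R by []; nra.
have C0 : C = 0.
  apply/eqP; rewrite -normr_le0; apply: (@archi_le0 _ (2 * A + `|sigma 1%N| + 2)) => n.
  have d1 : n.+1%:R ^+ 2 * m n.+2 <= m n.+1 := dec n.
  have e := rec n.+1.
  have : `|C| * m n.+1 <= (2 + A * n.+2%:R + `|sigma 1%N|) * m n.+2.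
    rewrite -[m n.+1 in leLHS]gtr0_norm // -normrM e.
    apply: le_trans (ler_normD _ _) _.
    rewrite !normrM (gtr0_norm (m0 n.+2)) (gtr0_norm (m0 n.+3)) normr_nat.
    have : `|A * n.+2%:R - sigma 1%N| <= A * n.+2%:R + `|sigma 1%N|.
      by apply: le_trans (ler_normB _ _) _; rewrite (ger0_norm (mulr_ge0 A0 _)).
    by move=> /(ler_wpM2r (ltW (m0 n.+2))); have := dec2 n.+1; lra.
  have := ler_wpM2l (normr_ge0 C) d1; rewrite mulrA => h1 h2.
  have := le_trans h1 h2; rewrite ler_pM2r // => h3.
  have n1 : 0 < n.+1%:R :> R by [].
  rewrite -(ler_pM2r n1) -mulrA -expr2; apply: le_trans h3 _.
  have : 0 <= `|sigma 1%N| by [].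
  rewrite -[n.+2%:R]natr1; have : 1 <= n.+1%:R :> R by rewrite ler1n.
  by nra.
have A00 : A = 0.
  apply/eqP; rewrite eq_le A0 andbT; apply: (@archi_le0 _ (sigma 1%N)) => n.
  rewrite -subr_le0 -(pmulr_lle0 _ (m0 n.+1)).
  have := rec n; rewrite C0 mul0r.
  by have := mulr_gt0 (ltr0Sn R n.+1) (m0 n.+2); lra.
have s1 : 0 < sigma 1%N.
  rewrite -(pmulr_lgt0 _ (m0 1%N)); have := rec 0%N; rewrite C0 A00.
  by have := m0 2%N; lra.
suff : sigma 1%N <= 0 by rewrite leNgt s1.
apply: (@archi_le0 _ 2) => n.
have := rec n; rewrite C0 A00 !mul0r sub0r => e.
have n1 : 1 <= n.+1%:R :> R by rewrite ler1n.
have := ler_wpM2l (ltW s1) (dec n).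
have -> : sigma 1%N * m n.+1 = n.+2%:R * m n.+2 by lra.
rewrite mulrA ler_pM2r // => h.
have n0 : 0 < n.+1%:R :> R by [].
by rewrite -(ler_pM2r n0) -mulrA -expr2; apply: le_trans h _; rewrite -natr1; lra.
Qed.
End NonDegeneracy.

(** * The radius of uniform convexity *)

Lemma ccvg_unique (R : realType) (u : nat -> R[i]) l l' : ccvg u l -> ccvg u l' -> l = l'.
Proof.
move=> h h'; apply/eqP; rewrite -subr_eq0 -cabs_eq0 eq_le cabs_ge0 andbT.
apply/ler_addgt0Pr => e e0; have e20 : 0 < e / 2 by lra.
near \oo => n.
have h1 : cabs (l - u n) <= e / 2 by near: n; exact: ccvg_near.
have h2 : cabs (l' - u n) <= e / 2 by near: n; exact: ccvg_near.
rewrite (_ : l - l' = (l - u n) - (l' - u n)); last by ring.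
by apply: le_trans (cabsB _ _) _; lra.
Unshelve. all: by end_near. Qed.

Section Radius.
Variables (R : realType) (nu : R) (sigma : nat -> R).
Hypothesis hnu : -1 < nu.
Hypothesis hsg : forall n, n.+1%:R * mu_coef nu n.+1 =
  - \sum_(k < n.+1) sigma k.+1 * mu_coef nu (n - k)%N.
Notation toC := (real_complex R).
Notation horC p z := (map_poly toC p).[z].
Notation dh := (pser (dh_coef nu)).
Notation d2h := (pser (shiftderiv (dh_coef nu))).
Notation delta := (pser (mu_coef nu)).

Let A := moment_ratio_sup sigma.

Lemma ffweight_norm_le (c : nat -> R) N n : `|ffweight R N n * c n| <= `|c n|.
Proof.
have /andP[w0 w1] := ffweight_itv R N n.
by rewrite normrM (ger0_norm w0) ler_piMl.
Qed.

Lemma ffweight_mul_cvg (c : nat -> R) n :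
  (fun N => ffweight R N n * c n) @ \oo --> c n.
Proof.
rewrite -[X in _ --> X]mul1r; apply: cvgM; last exact: cvg_cst.
exact: ffweight_cvg.
Qed.

Lemma coef_dh_poly_le N n : `|(dh_poly nu N)`_n| <= `|dh_coef nu n|.
Proof. by rewrite coef_dh_poly // ffweight_norm_le. Qed.

Lemma coef_delta_poly_le N n : `|(delta_poly nu N)`_n| <= `|mu_coef nu n|.
Proof. by rewrite coef_delta_poly // ffweight_norm_le. Qed.

Lemma coef_dh_poly_cvg n : (fun N => (dh_poly nu N)`_n) @ \oo --> dh_coef nu n.
Proof. by under eq_fun do rewrite coef_dh_poly //; exact: ffweight_mul_cvg. Qed.

Lemma coef_delta_poly_cvg n : (fun N => (delta_poly nu N)`_n) @ \oo --> mu_coef nu n.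
Proof. by under eq_fun do rewrite coef_delta_poly //; exact: ffweight_mul_cvg. Qed.

Lemma dh_add_d2h z : dh z + 2 * z * d2h z = delta z.
Proof.
have cD := ccvg_poly (entire_mu hnu) coef_delta_poly_le coef_delta_poly_cvg z.
have cH := ccvg_poly (entire_dh_coef hnu) coef_dh_poly_le coef_dh_poly_cvg z.
have cH' := ccvg_deriv_poly (entire_dh_coef hnu) coef_dh_poly_le coef_dh_poly_cvg z.
apply: ccvg_unique cD.
have E N : horC (delta_poly nu N) z = horC (dh_poly nu N) z + 2 * z * horC (dh_poly nu N)^`() z.
  rewrite /delta_poly rmorphD /= map_polyZ rmorphM /= map_polyX !hornerE.
  by rewrite (rmorph_nat toC).
rewrite /ccvg; under eq_fun do rewrite E.
have cb : (fun N => cabs (dh z - horC (dh_poly nu N) z) +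
    cabs (2 * z) * cabs (d2h z - horC (dh_poly nu N)^`() z)) @ \oo --> (0 : R).
  have := cvgD cH (cvgM (cvg_cst (cabs (2 * z) : R)) cH').
  by rewrite mulr0 addr0; apply.
apply: squeeze_cvgr (cvg_cst _) cb; apply: nearW => N; rewrite cabs_ge0 -cabsM /=.
set a := dh z; set b := d2h z; set a' := horC _ z; set b' := horC _ z.
rewrite (_ : _ - _ = (a - a') + 2 * z * (b - b')); first exact: cabsD.
by rewrite mulrBr; ring.
Qed.

Let nondeg := mu_nondegenerate hnu hsg.

Section Sequences.
Variables (s t : nat -> seq R).
Hypothesis s0 : forall N, {in s N, forall a, 0 < a}.
Hypothesis t0 : forall N, {in t N, forall a, 0 < a}.
Hypothesis sE : forall N, delta_poly nu N = rootprod (s N).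
Hypothesis tE : forall N, dh_poly nu N = rootprod (t N).

Let s0' N : {in s N, forall a, 0 <= a}. Proof. by move=> a /s0 /ltW. Qed.
Let t0' N : {in t N, forall a, 0 <= a}. Proof. by move=> a /t0 /ltW. Qed.

Let pc N n : `|(rootprod (s N))`_n| <= `|mu_coef nu n|.
Proof. by rewrite -sE coef_delta_poly_le. Qed.
Let pcvg n : (fun N => (rootprod (s N))`_n) @ \oo --> mu_coef nu n.
Proof. by under eq_fun do rewrite -sE; exact: coef_delta_poly_cvg. Qed.
Let scvg := cvg_psum pcvg hsg.

Lemma sigma_ratio_sup_gt0 : 0 < A.
Proof. exact: moment_ratio_sup_gt0 s0' scvg nondeg. Qed.

Lemma sigma_gt0 k : 0 < sigma k.+1.
Proof. exact: moment_gt0 s0' scvg nondeg k. Qed.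

Lemma sigma_expr_gt k : A ^+ k.+1 < sigma k.+1.
Proof. exact: moment_ratio_sup_expr_lt s0' scvg nondeg k. Qed.

Lemma sigmaS_lt k : sigma k.+2 < A * sigma k.+1.
Proof. exact: momentS_lt s0' scvg nondeg k. Qed.

Lemma delta_root : delta (A^-1)%:C = 0.
Proof. exact: pser_root (entire_mu hnu) s0' pc pcvg hsg nondeg. Qed.

Lemma delta_gt0 x : 0 <= x -> A * x < 1 -> 0 < complex.Re (delta x%:C).
Proof. exact: pser_gt0 (entire_mu hnu) s0' pc pcvg hsg nondeg x. Qed.

(** With u = h'(x), v = h''(x) and x = |z|: h'(z) has modulus at least u, and
|z h''(z)| u <= - x v |h'(z)|.  As u + 2 x v = Delta(x) > 0, the ratio - x v / u is
less than 1/2. *)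
Lemma quotient_lt_half z : A * cabs z < 1 ->
  dh z != 0 /\ cabs (z * d2h z / dh z) < 1 / 2.
Proof.
move=> Az; set x := cabs z in Az.
have x0 : 0 <= x := cabs_ge0 z.
(* The roots of H_N lie outside the disc because those of D_N do. *)
have nearN : \forall N \near \oo, {in t N, forall b, b * x < 1}.
  have := @near_maxs_lt1 _ s sigma s0' scvg nondeg x x0 Az; apply: filterS => N mx.
  apply: (@posroot_pullback _ (s N)) => //.
    by rewrite -sE -tE.
  by move=> a sa; apply: le_lt_trans mx; rewrite ler_wpM2r // le_maxs.
have e1 := entire_dh_coef hnu.
have cH := ccvg_poly e1 coef_dh_poly_le coef_dh_poly_cvg z.
have cH' := ccvg_deriv_poly e1 coef_dh_poly_le coef_dh_poly_cvg z.
have rH := @cvg_poly_real _ _ _ e1 coef_dh_poly_le coef_dh_poly_cvg x.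
have rH' := @cvg_deriv_poly_real _ _ _ e1 coef_dh_poly_le coef_dh_poly_cvg x.
set u := complex.Re (dh x%:C) in rH; set v := complex.Re (d2h x%:C) in rH'.
have D0 : 0 < u + 2 * x * v.
  have := delta_gt0 x0 Az; rewrite -dh_add_d2h raddfD /= -/u.
  rewrite (_ : 2 * x%:C * d2h x%:C = (2 * x)%:C * d2h x%:C); last by rewrite rmorphM rmorph_nat.
  by case E: (d2h x%:C) => [v1 v2]; rewrite /v E /= mul0r subr0.
have v0 : v <= 0.
  apply: (@ler_cvg_to _ _ _ _ _ _ _ _ rH' (cvg_cst 0)).
  apply: filterS nearN => N tx; rewrite tE.
  by have [||//] := @rootprod_sign _ (t N) x x0; [exact: t0'|move=> b /tx /ltW].
have xv : 0 <= - (x * v) by rewrite oppr_ge0 mulr_ge0_le0.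
have uh : u <= cabs (dh z).
  apply: (@ler_cvg_to _ _ _ _ _ _ _ _ rH (cvg_cabs cH)).
  by apply: filterS nearN => N tx; rewrite tE; apply: cabs_rootprod_ge => //; exact: t0'.
have key : (x * cabs (d2h z)) * u <= - (x * v) * cabs (dh z).
  have l1 : (fun N => x * cabs (horC (dh_poly nu N)^`() z) * (dh_poly nu N).[x]) @ \oo
      --> x * cabs (d2h z) * u.
    by apply: cvgM rH; apply: cvgM (cvg_cabs cH'); exact: cvg_cst.
  have l2 : (fun N => - (x * (dh_poly nu N)^`().[x]) * cabs (horC (dh_poly nu N) z)) @ \oo
      --> - (x * v) * cabs (dh z).
    by apply: cvgM (cvg_cabs cH); apply: cvgN; apply: cvgM rH'; exact: cvg_cst.
  apply: (@ler_cvg_to _ _ _ _ _ _ _ _ l1 l2).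
  apply: filterS nearN => N tx; rewrite tE.
  by rewrite -cabsM; apply: cabs_logderiv_le => //; exact: t0'.
have u0 : 0 < u by lra.
have hz0 : 0 < cabs (dh z) by exact: lt_le_trans uh.
split; first by rewrite -cabs_eq0 gt_eqF.
rewrite !cabsM cabsV ltr_pdivrMr // -/x -(ltr_pM2r u0).
apply: le_lt_trans key _; rewrite mulrAC ltr_pM2r //; lra.
Qed.
End Sequences.

Lemma root_sequences : exists s t : nat -> seq R,
  [/\ forall N, {in s N, forall a, 0 < a}, forall N, {in t N, forall a, 0 < a},
      forall N, delta_poly nu N = rootprod (s N) & forall N, dh_poly nu N = rootprod (t N)].
Proof.
have HD N : exists w : seq R, {in w, forall a, 0 < a} /\ delta_poly nu N = rootprod w.
  by have [w] := posrooted_delta_poly hnu N; exists w.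
have HH N : exists w : seq R, {in w, forall a, 0 < a} /\ dh_poly nu N = rootprod w.
  by have [w] := posrooted_dh_poly hnu N; exists w.
have [s Hs] := boolp.choice HD; have [t Ht] := boolp.choice HH.
by exists s, t; split=> N; [case: (Hs N)|case: (Ht N)|case: (Hs N)|case: (Ht N)].
Qed.

(** The radius is 1/A.  As 1/A is at most the radius of convexity, every number less
than 1/A satisfies the comparison between the two radii. *)
Lemma uniform_convexity_radius : exists r : R,
    [/\ radius_uniform_convexity (bessel_h nu) = r%:E,
        smallest_positive_root
          (fun z => cderiv (bessel_h nu) z
                    + 2 * z * cderiv (cderiv (bessel_h nu)) z) r
      & forall k : nat, (0 < k)%N ->
          sigma k `^ (- (1 / k%:R)) < r < sigma k / sigma k.+1].
Proof.
have [s [t [s0 t0 sE tE]]] := root_sequences.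
have A0 : 0 < A := sigma_ratio_sup_gt0 s0 sE.
have quo := quotient_lt_half s0 t0 sE tE.
have r0 : 0 < A^-1 by rewrite invr_gt0.
have Ar x : (A * x < 1) = (x < A^-1) by rewrite -[A^-1]mul1r ltr_pdivlMr // mulrC.
have cq z : convexity_quotient (bessel_h nu) z = z * d2h z / dh z.
  by rewrite /convexity_quotient cderiv2_bessel_h // cderiv_bessel_h.
have conv z : cabs z < A^-1 -> cderiv (bessel_h nu) z != 0 /\
    cabs (convexity_quotient (bessel_h nu) z) < 1 / 2.
  by rewrite -Ar => /quo; rewrite cq cderiv_bessel_h.
have Re1 (q : R[i]) : 'Re (1 + q) = (1 + complex.Re q)%:C.
  by rewrite -complexRe raddfD.
have Rege (q : R[i]) : cabs q < 1 / 2 -> 1 / 2 < 1 + complex.Re q.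
  by have := Re_le_cabs q; rewrite ler_norml => /andP[? _] ?; lra.
have rc : ((A^-1)%:E <= radius_convexity (bessel_h nu))%E.
  apply: ereal_sup_ubound; exists A^-1 => //; split=> // z.
  rewrite cabsE ltcR => /conv[h0 /Rege h]; split=> //.
  by rewrite Re1 ltcR; lra.
exists A^-1; split.
- apply/eqP; rewrite eq_le; apply/andP; split.
    apply: ge_ereal_sup => _ [rho [rho0 _ Hr] <-]; rewrite lee_fin leNgt; apply/negP => lt.
    have [|d0] := Hr (A^-1)%:C; first by rewrite cabsE ltcR cabs_real gtr0_norm.
    rewrite cq cderiv_bessel_h // in d0 *.
    have e := dh_add_d2h (A^-1)%:C; rewrite (delta_root s0 sE) in e.
    have -> : (A^-1)%:C * d2h (A^-1)%:C / dh (A^-1)%:C = (- (1 / 2))%:C.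
      apply: (mulIf d0); rewrite divfK //.
      have two : (2 : R[i]) != 0 by rewrite pnatr_eq0.
      apply: (mulfI two); rewrite [LHS]mulrA [RHS]mulrA.
      have -> : 2 * (- (1 / 2))%:C = -1 :> R[i].
        rewrite -[2 in LHS](rmorph_nat toC 2) -rmorphM -(rmorphN1 toC).
        by congr (_%:C); lra.
      by move/eqP: e; rewrite addrC addr_eq0 => /eqP ->; rewrite mulN1r.
    rewrite Re1 cabsE cabs_real ltcR /= normrN ger0_norm; lra.
  apply/lee_addgt0Pr => e e0.
  pose rho := Num.max (A^-1 - e) (A^-1 / 2).
  have rho0 : 0 < rho by rewrite lt_max divr_gt0 ?orbT.
  have rhor : rho < A^-1 by rewrite gt_max; apply/andP; split; lra.
  apply: (@le_trans _ _ (rho%:E + e%:E)%E).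
    by rewrite -EFinD lee_fin -lerBlDr le_max lexx.
  rewrite leeD2r //; apply: ereal_sup_ubound; exists rho => //; split=> //.
    by apply: lt_le_trans rc; rewrite lte_fin.
  move=> z; rewrite cabsE ltcR => zr; have [|d0 q] := conv z; first exact: lt_trans rhor.
  by split=> //; rewrite Re1 cabsE ltcR; have := Rege _ q; lra.
- split=> //.
    by rewrite cderiv2_bessel_h // cderiv_bessel_h // dh_add_d2h (delta_root s0 sE).
  move=> x x0; rewrite cderiv2_bessel_h // cderiv_bessel_h // dh_add_d2h => e.
  rewrite leNgt -Ar; apply/negP => Ax.
  by have := delta_gt0 s0 sE (ltW x0) Ax; rewrite e ltxx.
- case=> // k _; have sk := sigma_gt0 s0 sE k; have sk1 := sigma_gt0 s0 sE k.+1.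
  apply/andP; split; last first.
    by rewrite ltr_pdivlMr // mulrC ltr_pdivrMr // mulrC (sigmaS_lt s0 sE).
  rewrite powRN ltf_pV2 ?posrE ?powR_gt0 //.
  have -> : A = (A ^+ k.+1) `^ (1 / k.+1%:R).
    by rewrite -powR_mulrn ?(ltW A0) // -powRrM mul1r divff ?pnatr_eq0 // powRr1 // ltW.
  rewrite gt0_ltr_powR ?divr_gt0 // ?in_itv /= ?nnegrE ?exprn_ge0 ?ltW //.
  exact: (sigma_expr_gt s0 sE).
Qed.
End Radius.

(** * Gauss products, principal powers and the Bessel function *)

Section GammaFunction.
Variable R : realType.
Implicit Types (x t u : R).

Definition gauss_product x n : R := n`!%:R * n%:R `^ x / pochhammer x n.+1.

(** Convexity of exp between 0 and ln (1 + t), in the form of the two tangent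
inequalities at x ln (1 + t). *)
Lemma powR_bernoulli_le x t : 0 < x <= 1 -> 0 <= t -> (1 + t) `^ x <= 1 + x * t.
Proof.
move=> /andP[x0 x1] t0; have p0 : 0 < 1 + t by lra.
set u := ln (1 + t); have e1 : expR u = 1 + t by rewrite lnK.
have -> : (1 + t) `^ x = expR (x * u).
  by rewrite /powR gt_eqF.
have h1 : expR (x * u) * (1 + (1 - x) * u) <= expR u.
  rewrite [leRHS](_ : _ = expR (x * u) * expR ((1 - x) * u)); last first.
    by rewrite -expRD; congr expR; ring.
  by rewrite ler_wpM2l ?expR_ge0 // expR_ge1Dx.
have h2 : expR (x * u) * (1 - x * u) <= 1.
  rewrite -[leRHS](expRxMexpNx_1 (x * u)) ler_wpM2l ?expR_ge0 //.
  exact: expR_ge1Dx.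
have := ler_wpM2l (ltW x0) h1.
have : 0 <= 1 - x by lra.
by move=> /ler_wpM2l /(_ _ _ h2); rewrite e1; lra.
Qed.

Lemma gauss_product_gt0 x n : 0 < x -> (0 < n)%N -> 0 < gauss_product x n.
Proof.
move=> x0 n0; rewrite divr_gt0 ?pochhammer_gt0 // mulr_gt0 ?powR_gt0 ?ltr0n //.
exact: fact_gt0.
Qed.

(** The quotient of consecutive terms is (1 + 1/m)^x / (1 + x/(m+1)), and
ln (1 + 1/m) >= 1/(m+1). *)
Lemma gauss_product_ndecr x n : 0 < x -> gauss_product x n.+1 <= gauss_product x n.+2.
Proof.
move=> x0; rewrite /gauss_product [pochhammer x n.+3]pochhammerS [n.+2`!]factS natrM.
have P0 : 0 < pochhammer x n.+2 by exact: pochhammer_gt0.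
have F0 : 0 < n.+1`!%:R :> R by rewrite ltr0n fact_gt0.
have N1 : 0 < n.+1%:R :> R by [].
have N2 : 0 < n.+2%:R :> R by [].
have xn : 0 < x + n.+2%:R by rewrite addr_gt0.
have key : n.+1%:R `^ x * (x + n.+2%:R) <= n.+2%:R * n.+2%:R `^ x.
  (* Equivalent to ln (1 + 1/m) >= 1/(m+1) with m = n + 1. *)
  have e1 : expR (n.+2%:R^-1) <= n.+2%:R / n.+1%:R :> R.
    rewrite -[leRHS]invrK -[leLHS]invrK -expRN lef_pV2 ?posrE ?expR_gt0 ?invr_gt0 ?divr_gt0 //.
    apply: le_trans (expR_ge1Dx _); rewrite invf_div le_eqVlt; apply/orP; left; apply/eqP.
    by by rewrite -[n.+2%:R]natr1; field.
  have e2 : 1 + x / n.+2%:R <= (n.+2%:R / n.+1%:R) `^ x.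
    apply: (@le_trans _ _ (expR (n.+2%:R^-1) `^ x)).
      by rewrite -expRM mulrC expR_ge1Dx.
    by apply: ge0_ler_powR => //; rewrite ?nnegrE ?expR_ge0 ?divr_ge0 // ltW.
  have e3 : n.+2%:R `^ x = (n.+2%:R / n.+1%:R) `^ x * n.+1%:R `^ x :> R.
    by rewrite -powRM ?divr_ge0 // divfK // gt_eqF.
  rewrite e3 [leLHS]mulrC [leRHS]mulrA ler_wpM2r ?powR_ge0 //.
  have := ler_wpM2l (ltW N2) e2; rewrite mulrDr mulr1 mulrCA divff ?gt_eqF // mulr1.
  by rewrite addrC.
rewrite ler_pdivrMr // -mulrA; set X := n.+1%:R `^ x in key *; set Y := n.+2%:R `^ x in key *.
rewrite invfM [leRHS](_ : _ = n.+1`!%:R * ((n.+2%:R * Y) / (x + n.+2%:R))); last first.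
  move: (x + n.+2%:R) (pochhammer x n.+2) xn P0 => a P a0 P0.
  by field; rewrite !gt_eqF.
by rewrite ler_pM2l // ler_pdivlMr.
Qed.

(** Replacing n^x by (n+1)^x turns the product into a nonincreasing sequence, by
Bernoulli's inequality, which starts at 1/x. *)
Lemma gauss_product_le x n : 0 < x <= 1 -> gauss_product x n <= x^-1.
Proof.
move=> x01; have /andP[x0 x1] := x01.
apply: (@le_trans _ _ (n`!%:R * n.+1%:R `^ x / pochhammer x n.+1)).
  rewrite ler_wpM2r ?invr_ge0 ?(ltW (pochhammer_gt0 _ x0)) // ler_wpM2l //.
  by apply: ge0_ler_powR; rewrite ?nnegrE ?ler_nat ?(ltW x0).
elim: n => [|n IH].
  by rewrite fact0 powR1 mul1r /pochhammer big_ord1 addr0 mul1r.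
apply: le_trans IH; rewrite [pochhammer x n.+2]pochhammerS [n.+1`!]factS natrM.
have P0 : 0 < pochhammer x n.+1 by exact: pochhammer_gt0.
have N1 : 0 < n.+1%:R :> R by [].
have xn : 0 < x + n.+1%:R by rewrite addr_gt0.
have e3 : n.+2%:R `^ x = (1 + n.+1%:R^-1) `^ x * n.+1%:R `^ x :> R.
  rewrite -powRM ?addr_ge0 ?invr_ge0 //; congr (_ `^ _).
  by rewrite mulrDl mul1r mulVf ?gt_eqF // natr1.
have b : (1 + n.+1%:R^-1) `^ x * n.+1%:R <= x + n.+1%:R :> R.
  have := @powR_bernoulli_le x n.+1%:R^-1 x01; rewrite invr_ge0 ltW // => /(_ isT).
  move=> /(ler_wpM2r (ltW N1)); rewrite mulrDl mul1r divfK ?gt_eqF //.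
  by rewrite [_%:R + x]addrC.
rewrite e3; set B := _ `^ x in b *; set X := n.+1%:R `^ x.
have X0 : 0 <= X by exact: powR_ge0.
rewrite [leLHS](_ : _ = (n`!%:R * X / pochhammer x n.+1) * 
  ((B * n.+1%:R) / (x + n.+1%:R))); last first.
  move: (x + n.+1%:R) (pochhammer x n.+1) xn P0 => a P a0 P0.
  by field; rewrite !gt_eqF.
rewrite ler_piMr ?ler_pdivrMr ?mul1r //.
by rewrite divr_ge0 ?mulr_ge0 ?(ltW P0).
Qed.

Lemma gauss_productS x n : 0 < x ->
  gauss_product (x + 1) n = gauss_product x n * (x * (1 - (x + 1) / (x + n.+1%:R))).
Proof.
move=> x0; have P0 : 0 < pochhammer x n.+1 by exact: pochhammer_gt0.
have xn : 0 < x + n.+1%:R by rewrite addr_gt0.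
have E : x * pochhammer (x + 1) n.+1 = pochhammer x n.+1 * (x + n.+1%:R).
  rewrite -pochhammerS [RHS]/pochhammer big_ord_recl addr0; congr (_ * _).
  by apply: eq_bigr => i _; rewrite lift0 -natr1 addrAC addrA.
rewrite /gauss_product; have -> : pochhammer (x + 1) n.+1 = pochhammer x n.+1 * (x + n.+1%:R) / x.
  by rewrite -E mulrC mulKf ?gt_eqF.
rewrite powRD; last by rewrite gt_eqF ?addr_gt0.
rewrite powRr1 //.
have -> : n%:R = x + n.+1%:R - (x + 1) :> R by rewrite -natr1; ring.
move: (x + n.+1%:R) (pochhammer x n.+1) (_ `^ _) xn P0 => a P X a0 P0.
by field; rewrite !gt_eqF.
Qed.

Lemma gauss_product_ratio_cvg x : 0 < x -> (fun n => 1 - (x + 1) / (x + n.+1%:R)) @ \oo --> (1 : R).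
Proof.
move=> x0; have h : (fun n => (x + 1) * n.+1%:R^-1) @ \oo --> (0 : R).
  rewrite -(mulr0 (x + 1)); apply: cvgM; first exact: cvg_cst.
  exact: cvg_harmonic.
have h' : (fun n : nat => (x + 1) / (x + n.+1%:R)) @ \oo --> (0 : R).
  apply: squeeze_cvgr (cvg_cst _) h; apply: nearW => n.
  have x1 : 0 <= x + 1 by rewrite addr_ge0 // ltW.
  have xn : 0 < x + n.+1%:R by rewrite addr_gt0.
  apply/andP; split; first by rewrite divr_ge0 // ltW.
  by rewrite ler_wpM2l // lef_pV2 ?posrE // lerDr ltW.
have := cvgB (cvg_cst (1 : R)) h'; rewrite subr0; exact.
Qed.

(** For x <= 1 the sequence is monotone and bounded; larger x are reached by unit
steps with gauss_productS. *)
Lemma gauss_product_cvg x : 0 < x -> exists2 l : R, 0 < l & gauss_product x @ \oo --> l.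
Proof.
suff H m : forall y, 0 < y <= m.+1%:R -> exists2 l : R, 0 < l & gauss_product y @ \oo --> l.
  move=> x0; apply: (H (Num.truncn x)); rewrite x0 /=.
  by rewrite ltW // truncnS_gt.
elim: m => [|m IH] y /andP[y0 ym].
  have nd : {homo (fun n => gauss_product y n.+1) : a b / (a <= b)%N >-> a <= b}.
    by apply/nondecreasing_seqP => n; exact: gauss_product_ndecr.
  have ub : has_ubound (range (fun n => gauss_product y n.+1)).
    by exists y^-1 => _ [n _ <-]; apply: gauss_product_le; rewrite y0.
  exists (sup (range (fun n => gauss_product y n.+1))).
    apply: lt_le_trans (gauss_product_gt0 y0 (ltn0Sn 0)) _.
    by apply: sup_ubound => //; exists 0%N.
  by rewrite -cvg_shiftS; exact: nondecreasing_cvgn.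
have [y1|y1] := leP y 1; first by apply: IH; rewrite y0 (le_trans y1) // ler1n.
have [z yE] : exists z, y = z + 1 by exists (y - 1); rewrite subrK.
have z0 : 0 < z by lra.
have [|l l0 cl] := IH z; first by rewrite z0 -(lerD2r 1) -yE natr1.
exists (l * (z * 1)); first by rewrite mulr1 mulr_gt0.
rewrite yE (funext (fun n => gauss_productS n z0)).
apply: cvgM => //; apply: cvgM; first exact: cvg_cst.
exact: gauss_product_ratio_cvg.
Qed.

Lemma Gamma_cvg x : 0 < x -> gauss_product x @ \oo --> Gamma x.
Proof.
move=> x0; have [l _ h] := gauss_product_cvg x0.
have hd : hausdorff_space R by exact: norm_hausdorff.
by rewrite /Gamma -/(gauss_product x) (cvg_lim hd h).
Qed.

Lemma Gamma_gt0 x : 0 < x -> 0 < Gamma x.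
Proof.
move=> x0; have [l l0 h] := gauss_product_cvg x0.
have hd : hausdorff_space R by exact: norm_hausdorff.
by rewrite /Gamma -/(gauss_product x) (cvg_lim hd h).
Qed.

Lemma GammaS x : 0 < x -> Gamma (x + 1) = x * Gamma x.
Proof.
move=> x0; have hd : hausdorff_space R by exact: norm_hausdorff.
have h := Gamma_cvg (addr_gt0 x0 ltr01).
have h' : gauss_product (x + 1) @ \oo --> Gamma x * (x * 1).
  rewrite (funext (fun n => gauss_productS n x0)).
  apply: cvgM; first exact: Gamma_cvg.
  by apply: cvgM; [exact: cvg_cst|exact: gauss_product_ratio_cvg].
by rewrite -(cvg_lim hd h) (cvg_lim hd h') mulr1 mulrC.
Qed.

Lemma Gamma_pochhammer x n : 0 < x -> Gamma (x + n%:R) = Gamma x * pochhammer x n.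
Proof.
move=> x0; elim: n => [|n IH]; first by rewrite addr0 /pochhammer big_ord0 mulr1.
rewrite -natr1 addrA GammaS ?ltr_wpDr // IH pochhammerS; ring.
Qed.
End GammaFunction.

Section PrincipalPowers.
Variable R : realType.
Implicit Types (z w : R[i]) (a b t x : R).

Definition cis t : R[i] := cos t +i* sin t.

Lemma cisD a b : cis (a + b) = cis a * cis b.
Proof. by apply/eqP; rewrite eq_complex /= cosD sinD; apply/andP; split; apply/eqP; ring. Qed.

Lemma cpowRE z a : cpowR z a = (cabs z `^ a)%:C * cis (a * carg z).
Proof. by []. Qed.

Lemma cabs_cis t : cabs (cis t) = 1.
Proof. by rewrite /cabs normc_def /= cos2Dsin2 sqrtr1. Qed.

Lemma cabs_gt0 z : z != 0 -> 0 < cabs z.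
Proof. by move=> z0; rewrite lt_def cabs_ge0 cabs_eq0 z0. Qed.

Lemma sqr_cabs z : cabs z ^+ 2 = complex.Re z ^+ 2 + complex.Im z ^+ 2.
Proof. by rewrite /cabs normc_def /= sqr_sqrtr // addr_ge0 // sqr_ge0. Qed.

Lemma Re_cabs_itv z : z != 0 -> -1 <= complex.Re z / cabs z <= 1.
Proof.
move=> z0; have c0 := cabs_gt0 z0.
rewrite -ler_norml normrM normfV (gtr0_norm c0) ler_pdivrMr // mul1r.
exact: Re_le_cabs.
Qed.

Lemma carg_itv z : z != 0 -> - pi <= carg z <= pi.
Proof.
move=> /Re_cabs_itv h; have := acos_ge0 h; have := acos_lepi h.
have := pi_ge0 R; rewrite /carg -/(cabs z); case: ifP => _ p0 h1 h2; apply/andP; split; lra.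
Qed.

Lemma polar z : z != 0 -> z = (cabs z)%:C * cis (carg z).
Proof.
move=> z0; have c0 := cabs_gt0 z0; have h := Re_cabs_itv z0.
have hcos : cos (acos (complex.Re z / cabs z)) = complex.Re z / cabs z.
  by apply: acosK; rewrite in_itv.
have hsin : sin (acos (complex.Re z / cabs z)) = `|complex.Im z| / cabs z.
  rewrite sin_acos // -[RHS]ger0_norm ?divr_ge0 ?cabs_ge0 // -sqrtr_sqr; congr Num.sqrt.
  rewrite !expr_div_n real_normK ?num_real //.
  have c2 : cabs z ^+ 2 != 0 by rewrite expf_neq0 ?gt_eqF.
  by rewrite -[1](divff c2) -mulrBl sqr_cabs addrC addKr.
rewrite /cis /carg -/(cabs z); apply/eqP; rewrite eq_complex /=.
case: ifPn => [i0|]; last rewrite -ltNge => i0; rewrite ?cosN ?sinN hcos hsin.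
  by rewrite ger0_norm // !mul0r subr0 addr0
  ![cabs z * _]mulrC !divfK ?lt0r_neq0 // !eqxx.
by rewrite ltr0_norm // mulNr opprK !mul0r subr0 addr0
  ![cabs z * _]mulrC !divfK ?lt0r_neq0 // !eqxx.
Qed.

(** Half of a principal argument lies in this interval, so taking a power of the
principal square root of z does not leave the principal branch. *)
Lemma carg_polar x t : 0 < x -> - (pi / 2) <= t <= pi / 2 -> carg (x%:C * cis t) = t.
Proof.
move=> x0 /andP[t1 t2]; have p0 := pi_gt0 R.
rewrite /carg -/(cabs _) cabsM cabs_real cabs_cis mulr1 gtr0_norm //=.
rewrite !mul0r subr0 addr0 mulrAC divff ?gt_eqF // mul1r pmulr_rge0 //.
have [t0|t0] := leP 0 t.
  rewrite sin_ge0_pi; last by apply/andP; split; lra.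
  by apply: cosK; rewrite in_itv /=; apply/andP; split; lra.
rewrite ifF; last first.
  apply/negbTE; rewrite -ltNge -oppr_gt0 -sinN; apply: sin_gt0_pi.
  by apply/andP; split; lra.
by rewrite cosKN ?opprK //; apply/andP; split; lra.
Qed.

Lemma cpowRD z a b : z != 0 -> cpowR z a * cpowR z b = cpowR z (a + b).
Proof.
move=> z0; rewrite !cpowRE mulrDl cisD powRD; last first.
  by rewrite (cabs_eq0 z) (negPf z0) implybT.
by rewrite rmorphM mulrACA.
Qed.

Lemma cpowR1 z : z != 0 -> cpowR z 1 = z.
Proof. by move=> z0; rewrite cpowRE mul1r powRr1 ?cabs_ge0 // -polar. Qed.

Lemma cpowR_half_pow z x a : z != 0 -> 0 < x ->
  cpowR (cpowR z (1 / 2) * x%:C) a = (x `^ a)%:C * cpowR z (a / 2).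
Proof.
move=> z0 x0; have c0 := cabs_gt0 z0.
have /andP[k1 k2] := carg_itv z0.
rewrite [cpowR z _]cpowRE mulrAC -rmorphM.
rewrite cpowRE carg_polar; last 2 first.
- by rewrite mulr_gt0 ?powR_gt0.
- by apply/andP; split; lra.
rewrite cabsM cabs_cis mulr1 cabs_real ger0_norm ?mulr_ge0 ?powR_ge0 ?(ltW x0) //.
rewrite powRM ?powR_ge0 ?(ltW x0) // -powRrM cpowRE.
rewrite (_ : 1 / 2 * a = a / 2); last by ring.
rewrite (_ : a * (1 / 2 * carg z) = a / 2 * carg z); last by ring.
by rewrite rmorphM mulrAC mulrC.
Qed.
End PrincipalPowers.

Lemma bessel_h_besselJ (R : realType) (nu : R) (z : R[i]) : -1 < nu -> z != 0 ->
  bessel_h nu z =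
    (2 `^ nu * Gamma (nu + 1))%:C * cpowR z (1 - nu / 2)
    * besselJ nu (cpowR z (1 / 2)).
Proof.
move=> hnu z0; have nu1 : 0 < nu + 1 by lra.
have G0 := Gamma_gt0 nu1.
set w := cpowR z (1 / 2).
have two : w / 2 = w * (2^-1 : R)%:C by rewrite fmorphV rmorph_nat.
have w2 : (w / 2) ^+ 2 = (4^-1)%:C * z.
  rewrite two exprMn expr2 /w cpowRD // (_ : 1 / 2 + 1 / 2 = 1); last by lra.
  rewrite cpowR1 // mulrC -rmorphXn; congr (_%:C * _).
  by rewrite exprVn -natrX.
have cv := pser_ccvg z (entire_bessel_coef hnu).
have scale (k : R[i]) (u : nat -> R[i]) : (forall n, u n = k * ((bessel_coef nu n)%:C * z ^+ n)) ->
    csum u = k * pser (bessel_coef nu) z.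
  move=> uE; apply: csum_unique.
  have h : (fun n => cabs k *
      cabs (pser (bessel_coef nu) z - ptrunc (bessel_coef nu) n z)) @ \oo --> (0 : R).
    by rewrite -(mulr0 (cabs k)); apply: cvgM => //; exact: cvg_cst.
  rewrite /ccvg; under eq_fun do rewrite (eq_bigr _ (fun n _ => uE n)) -mulr_sumr -mulrBr cabsM.
  exact: h.
have -> : bessel_h nu z = z * pser (bessel_coef nu) z.
  by apply: scale => n; rewrite exprS /bessel_coef mulrCA.
rewrite /besselJ (scale (Gamma (nu + 1))^-1%:C); last first.
  move=> n; rewrite exprM w2 exprMn mulrA mulrA -rmorphXn -!rmorphM; congr (_%:C * _).
  rewrite addrAC Gamma_pochhammer // /bessel_coef exprVn.
  have pn := pochhammer_nu_neq0 hnu n.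
  have fn : n`!%:R != 0 :> R by rewrite pnatr_eq0 -lt0n fact_gt0.
  have f4 : 4 ^+ n != 0 :> R by rewrite expf_neq0.
  by field; rewrite pn fn f4 gt_eqF.
rewrite two cpowR_half_pow //.
rewrite {1}(_ : z = cpowR z (1 - nu / 2) * cpowR z (nu / 2)); last first.
  by rewrite cpowRD // subrK cpowR1.
set P := pser _ _; set c1 := cpowR z _; set c2 := cpowR z _.
have E : (2 `^ nu * Gamma (nu + 1))%:C * (2^-1 `^ nu)%:C * (Gamma (nu + 1))^-1%:C = 1 :> R[i].
  rewrite -!rmorphM -(rmorph1 (real_complex R)); congr (_%:C).
  rewrite mulrAC mulfK ?gt_eqF // -powRM // divff // powR1 //.
rewrite -[LHS]mul1r -E; ring.
Qed.

(** * Bessel representation and radius of uniform convexity of h_nu *)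

Theorem lemma6 (R : realType) (nu : R) (hnu : -1 < nu) (sigma : nat -> R)
    (hsigma : forall n : nat,
      - sigma n.+1 =
        \sum_(0 <= m < n.+1) pi_coef nu m * lambda_coef nu (n - m)) :
  (forall z : R[i], z != 0 ->
    bessel_h nu z =
      (2 `^ nu * Gamma (nu + 1))%:C * cpowR z (1 - nu / 2)
      * besselJ nu (cpowR z (1 / 2))) /\
  exists r : R,
    [/\ radius_uniform_convexity (bessel_h nu) = r%:E,
        smallest_positive_root
          (fun z => cderiv (bessel_h nu) z
                    + 2 * z * cderiv (cderiv (bessel_h nu)) z) r
      & forall k : nat, (0 < k)%N ->
          sigma k `^ (- (1 / k%:R)) < r < sigma k / sigma k.+1].
Proof.
split; first by move=> z; exact: bessel_h_besselJ.
exact: uniform_convexity_radius hnu (sigma_newton hnu hsigma).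
Qed.
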